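(* Let $d\ge 1$, $s\in(0,1)$ and $\alpha\in(s,1)$. There exists a constant $C>0$, depending only on $d$ and $s$, with the following property. Let $E\subset\mathbb{R}^d$ be an open set with $C^{1,\alpha}$ boundary and $0\in\partial E$. If $H_{s,E}(x)=0$ for every $x\in\partial E$, then \[ |E\cap B_R|\ge C\,|B_R|\qquad\text{for all }R>0. \]
   Context: $B_R$ is the open ball of radius $R$ centred at $0$, $B_\varepsilon(x)$ the open ball of radius $\varepsilon$ centred at $x$, and $|F|$ denotes Lebesgue measure. For a set $E$, $\tilde\chi_E=\chi_{\mathbb{R}^d\setminus E}-\chi_E$, where $\chi_F$ is the characteristic function of $F$. The $s$-mean curvature of $E$ at $x\in\partial E$ is \[ H_{s,E}(x)=\lim_{\varepsilon\to0^+}\int_{\mathbb{R}^d\setminus B_\varepsilon(x)}\frac{\tilde\chi_E(y)}{|x-y|^{d+s}}\,dy, \] whenever this limit exists. The hypothesis $H_{s,E}=0$ on $\partial E$ means that this limit exists and equals $0$ at every boundary point. *)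

(* Defs.v *)
From HB Require Import structures.
From mathcomp Require Import all_boot all_order all_algebra.
From mathcomp Require Import all_classical all_reals all_analysis.
Set Implicit Arguments. Unset Strict Implicit. Unset Printing Implicit Defensive.
Import Order.TTheory GRing.Theory Num.Theory.
Import numFieldNormedType.Exports.
Local Open Scope classical_set_scope.
Local Open Scope ring_scope.

Section Defs.
Variable R : realType.

(* Euclidean norm on R^d (the library's norm on 'rV is the sup norm). *)
Definition enorm (d : nat) (v : 'rV[R]_d) : R := Num.sqrt (\sum_(i < d) v 0 i ^+ 2).

Definition eball (d : nat) (x : 'rV[R]_d) (r : R) : set 'rV[R]_d :=
  [set y | enorm (y - x) < r].

Definition boundary (d : nat) (E : set 'rV[R]_d) : set 'rV[R]_d :=
  closure E `\` interior E.

Definition vcons (n : nat) (x : R) (v : 'rV[R]_n) : 'rV[R]_n.+1 :=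
  \row_(i < n.+1) match unlift ord0 i with Some j => v 0 j | None => x end.

Fixpoint iter_int (n : nat) : ('rV[R]_n -> \bar R) -> \bar R :=
  match n with
  | 0 => fun f => f 0
  | n'.+1 => fun f =>
      (\int[@lebesgue_measure R]_x iter_int (fun v => f (vcons x v)))%E
  end.

(* d-dimensional Lebesgue measure |F| (by Tonelli, for Borel sets this is the
   product Lebesgue measure; all sets used below are open) *)
Definition lebd (d : nat) (F : set 'rV[R]_d) : \bar R :=
  iter_int (fun v => (\1_F v)%:E).

Definition intd (d : nat) (f : 'rV[R]_d -> R) : \bar R :=
  (iter_int (fun v => (Num.max (f v) 0)%:E) -
   iter_int (fun v => (Num.max (- f v) 0)%:E))%E.

Definition chit (d : nat) (E : set 'rV[R]_d) (y : 'rV[R]_d) : R :=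
  \1_(~` E) y - \1_E y.

Definition Hs_trunc (d : nat) (s : R) (E : set 'rV[R]_d) (x : 'rV[R]_d)
  (eps : R) : \bar R :=
  intd (fun y => if `[< eball x eps y >] then 0
                 else chit E y / (enorm (x - y)) `^ (d%:R + s)).

Definition Hs_zero_at (d : nat) (s : R) (E : set 'rV[R]_d) (x : 'rV[R]_d) :=
  Hs_trunc s E x @ 0^'+ --> (0 : \bar R).

Definition evec (n : nat) (i : 'I_n) : 'rV[R]_n := delta_mx 0 i.

Definition C1alpha (n : nat) (alpha : R) (g : 'rV[R]_n -> R) :=
  (forall y, differentiable g y) /\
  exists K : R, forall (i : 'I_n) (y z : 'rV[R]_n),
    `| 'D_(evec i) g y - 'D_(evec i) g z | <= K * (enorm (y - z)) `^ alpha.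

Definition vinit (n : nat) (z : 'rV[R]_n.+1) : 'rV[R]_n :=
  \row_(j < n) z 0 (widen_ord (leqnSn n) j).
Definition vlast (n : nat) (z : 'rV[R]_n.+1) : R := z 0 ord_max.

(* E has C^{1,alpha} boundary: near every boundary point x, in suitable
   rotated coordinates y = x + z Q (Q orthogonal), E is the supergraph
   {z_d > g(z')} of a C^{1,alpha} function g. *)
Definition C1alpha_boundary (n : nat) (alpha : R) (E : set 'rV[R]_n.+1) :=
  forall x, boundary E x ->
  exists r : R, 0 < r /\
  exists Q : 'M[R]_n.+1, Q *m Q^T = 1%:M /\
  exists g : 'rV[R]_n -> R, C1alpha alpha g /\
  forall z : 'rV[R]_n.+1, enorm z < r ->
    (E (x + z *m Q) <-> g (vinit z) < vlast z).

End Defs.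

(* Main.v *)
Require Import Defs.
From HB Require Import structures.
From mathcomp Require Import all_boot all_order all_algebra.
From mathcomp Require Import all_classical all_reals all_analysis.
From mathcomp Require Import measurable_realfun ring lra.
Import Order.TTheory GRing.Theory Num.Theory.
Import numFieldNormedType.Exports.
Set Implicit Arguments.
Unset Strict Implicit.
Unset Printing Implicit Defensive.
Local Open Scope classical_set_scope.
Local Open Scope ring_scope.

(* If E filled too small a part of B_R, then Vitali's covering argument (the weak
   (1,1) bound for the maximal function of E) would give a point z near 0 such
   that E has density at most eta in every cube centred at z of size up to a
   multiple of R.  Let y be a point of the closure of E nearest to z, and
   t = |y - z|, which is small compared with R since 0 is in the closure of E.
   Then y is a boundary point and B_t(z) is an exterior ball touching E at y.
   Take delta = t / b with b a large constant.  Inside B_delta(y), reflecting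
   through y shows that the contribution of E to H_{s,E}(y) exceeds that of its
   complement by at most the integral of the kernel over the region between two
   tangent balls of radius t, which is of order delta^(1-s) / t.  Outside
   B_delta(y), E is thin at all scales up to a large multiple of delta, so the
   complement wins by an amount of order delta^(-s).  Hence the truncated
   curvature at y stays above a positive constant, contradicting H_{s,E}(y) = 0.
   If t = 0, the exterior estimate alone, with delta equal to the truncation
   radius, gives the contradiction. *)

(** * Measures bundled with a proof of sigma-finiteness *)

Section sigma_finite_measure_of.
Context d (T : measurableType d) (R : realType).
Variable mu : {measure set T -> \bar R}.
Hypothesis mu_sf : sigma_finite setT mu.

(* The proof is kept in the term so that the instances below can find it. *)
Definition sigma_finite_measure_of : set T -> \bar R := let _ := mu_sf in mu.

HB.instance Definition _ := Measure.on sigma_finite_measure_of.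
HB.instance Definition _ :=
  Measure_isSigmaFinite.Build _ _ _ sigma_finite_measure_of mu_sf.

End sigma_finite_measure_of.

(** * Lebesgue measure on row vectors *)

(** Sealed with [Qed], so that unification cannot identify this display with another one. *)
Definition rV_display : measure_display -> measure_display.
Proof. exact. Qed.

Definition rV_coord (R : realType) n (i : 'I_n) (v : 'rV[R]_n) :
  measurableTypeR R := v 0 i.

Section measurable_rV.
Variables (R : realType) (n : nat).
Local Notation coords := (@rV_coord R n).

Let rV_set0 : g_sigma_preimage coords set0.
Proof. exact: sigma_algebra0. Qed.

Let rV_setC A : g_sigma_preimage coords A -> g_sigma_preimage coords (~` A).
Proof. exact: sigma_algebraC. Qed.

Let rV_bigcup (F : _^nat) : (forall i, g_sigma_preimage coords (F i)) ->
  g_sigma_preimage coords (\bigcup_i (F i)).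
Proof. exact: sigma_algebra_bigcup. Qed.

(** The product sigma-algebra, generated by the coordinates; [open_measurable_rV] shows that it
    contains the open sets. *)
HB.instance Definition _ := @isMeasurable.Build (rV_display R.-ocitv)
  'rV[R]_n (g_sigma_preimage coords) rV_set0 rV_setC rV_bigcup.

Lemma measurable_coord (i : 'I_n) :
  measurable_fun [set: 'rV[R]_n] (fun v : 'rV[R]_n => v 0 i).
Proof.
move=> _ Y mY; rewrite setTI; apply: sub_sigma_algebra => /=.
rewrite -bigcup_seq/=; exists i => /=; first by rewrite mem_index_enum.
by exists Y => //; rewrite setTI.
Qed.

Lemma measurable_fun_rVP d (T : measurableType d) (f : T -> 'rV[R]_n) :
  (forall i, measurable_fun [set: T] (fun x => f x 0 i)) ->
  measurable_fun [set: T] f.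
Proof.
move=> mf.
have sub : g_sigma_preimage (fun i => coords i \o f) `<=` measurable.
  apply: smallest_sub; first exact: sigma_algebra_measurable.
  rewrite -bigcup_seq; apply: bigcup_sub => i Ii.
  by move=> A [B mB <-]; exact: mf.
move=> _ A mA; apply: sub; rewrite g_sigma_preimage_comp; by exists A.
Qed.

End measurable_rV.

Section lebesgue_rV.
Variable R : realType.
Local Notation leb := (@lebesgue_measure R).

Lemma measurable_vcons n :
  measurable_fun [set: measurableTypeR R * 'rV[R]_n]
    (fun xv => vcons xv.1 xv.2 : 'rV[R]_n.+1).
Proof.
apply: measurable_fun_rVP => i.
case: (unliftP ord0 i) => [j ->|->].
  rewrite (_ : (fun _ => _) = (fun v : 'rV[R]_n => v 0 j) \o snd).
    by apply: measurableT_comp => //; exact: measurable_coord.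
  by apply/funext => -[x v] /=; rewrite mxE liftK.
rewrite (_ : (fun _ => _) = fst) //.
by apply/funext => -[x v] /=; rewrite mxE unlift_none.
Qed.

(** Bridge from the iterated integrals of the statement to integration theory. In the inductive step
    the measure is the image of a product measure under [vcons], and Tonelli's theorem unfolds one
    coordinate. Sigma-finiteness is carried along because the next product needs it. *)
Lemma iter_int_measure n :
  exists mu : {sigma_finite_measure set 'rV[R]_n -> \bar R},
  forall f : 'rV[R]_n -> \bar R,
  measurable_fun setT f -> (forall v, 0 <= f v)%E ->
  (\int[mu]_v f v = iter_int f)%E.
Proof.
elim: n => [|n [mu muE]].
  (* Dimension zero has a single point, and integration is evaluation there. *)
  exists (\d_(0 : 'rV[R]_0)) => f mf f0.
  by rewrite integral_dirac//= diracT mul1e.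
pose phi (xv : measurableTypeR R * 'rV[R]_n) : 'rV[R]_n.+1 := vcons xv.1 xv.2.
have mphi : measurable_fun setT phi := @measurable_vcons n.
pose nu : {measure set 'rV[R]_n.+1 -> \bar R} :=
  measure_function_pushforward__canonical__measure_function_Measure (leb \x mu)%E mphi.
have nu_sf : sigma_finite setT nu.
  have [F FT mF] : sigma_finite setT (leb \x mu)%E.
    have /sigma_finiteP[F [FT ndF Foo]] := @sigma_finiteT _ _ _ leb.
    have /sigma_finiteP[G [GT ndG Goo]] := sigma_finiteT mu.
    exists (fun k => F k `*` G k).
      rewrite -setXTT FT GT predeqE => -[x y]; split.
        move=> [/= [i _ Fix] [k _ Gky]]; exists (maxn i k) => //; split.
        - by move: x Fix; exact/subsetPset/ndF/leq_maxl.
        - by move: y Gky; exact/subsetPset/ndG/leq_maxr.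
      by move=> [k _ []/= ? ?]; split; exists k.
    move=> k; have [? ?] := Foo k; have [? ?] := Goo k.
    split; first exact: measurableX.
    by rewrite product_measure1E// lte_mul_pinfty// ge0_fin_numE.
  (* The measurable inverse of [phi] carries an exhaustion of the product over to row vectors. *)
  pose psi (v : 'rV[R]_n.+1) : measurableTypeR R * 'rV[R]_n :=
    (v 0 ord0, \row_j v 0 (lift ord0 j)).
  have mpsi : measurable_fun setT psi.
    apply: measurable_fun_pair; first exact: measurable_coord.
    apply: measurable_fun_rVP => i.
    rewrite (_ : (fun _ => _) = fun v : 'rV[R]_n.+1 => v 0 (lift ord0 i)).
      exact: measurable_coord.
    by apply/funext => v; rewrite mxE.
  have phiK : cancel phi psi.
    case=> x v; rewrite /psi /phi/= mxE unlift_none; congr pair.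
    by apply/rowP => j; rewrite !mxE liftK.
  exists (fun k => psi @^-1` F k).
    by rewrite -preimage_bigcup -FT preimage_setT.
  move=> k; split.
    by rewrite -[X in measurable X]setTI; apply: mpsi => //; exact: (mF k).1.
  have := (mF k).2; rewrite /= /pushforward -comp_preimage.
  by rewrite (_ : psi \o phi = id)//; apply/funext.
exists (sigma_finite_measure_of nu_sf) => f mf f0.
have mfphi : measurable_fun setT (f \o phi) by exact: measurableT_comp.
rewrite ge0_integral_pushforward//= fubini_tonelli1//.
apply: eq_integral => x _; rewrite -muE//.
exact: (measurableT_comp mfphi (@measurable_pair1 _ _ _ _ x)).
Qed.
End lebesgue_rV.

Section lebesgue_rV_theory.
Variable R : realType.
Local Notation leb := (@lebesgue_measure R).

Definition lebrV n : {sigma_finite_measure set 'rV[R]_n -> \bar R} :=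
  projT1 (cid (iter_int_measure R n)).

Lemma integral_lebrV n (f : 'rV[R]_n -> \bar R) :
  measurable_fun setT f -> (forall v, 0 <= f v)%E ->
  (\int[lebrV n]_v f v = iter_int f)%E.
Proof. exact: (projT2 (cid (iter_int_measure R n))). Qed.

Lemma lebd_lebrV n (A : set 'rV[R]_n) : measurable A -> lebd A = lebrV n A.
Proof.
move=> mA; rewrite /lebd -integral_lebrV//.
- by rewrite integral_indic// setIT.
- exact/measurable_EFinP/measurable_indic.
Qed.

Lemma measurable_fun_vcons n (f : 'rV[R]_n.+1 -> \bar R) (x : R) :
  measurable_fun setT f -> measurable_fun setT (fun v : 'rV[R]_n => f (vcons x v)).
Proof.
move=> mf; have mfv := measurableT_comp mf (@measurable_vcons R n).
exact: (measurableT_comp mfv (pair1_measurable (x : measurableTypeR R))).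
Qed.

Lemma measurable_integral_vcons n (f : 'rV[R]_n.+1 -> \bar R) :
  measurable_fun setT f -> (forall v, 0 <= f v)%E ->
  measurable_fun setT (fun x : R => \int[lebrV n]_v f (vcons x v))%E.
Proof.
move=> mf f0; have mfv := measurableT_comp mf (@measurable_vcons R n).
have := measurable_fun_fubini_tonelli_F (m2 := lebrV n) _ mfv.
by rewrite /fubini_F; apply => xv; exact: f0.
Qed.

Lemma integral_lebrVS n (f : 'rV[R]_n.+1 -> \bar R) :
  measurable_fun setT f -> (forall v, 0 <= f v)%E ->
  (\int[lebrV n.+1]_v f v = \int[leb]_x \int[lebrV n]_v f (vcons x v))%E.
Proof.
move=> mf f0; rewrite integral_lebrV//=; apply: eq_integral => x _.
by rewrite integral_lebrV//; exact: measurable_fun_vcons.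
Qed.

(** The translated measure agrees with Lebesgue measure on the intervals []a, b]], hence everywhere
    by uniqueness. *)
Lemma integral_lebesgue_translation (c : R) (f : R -> \bar R) :
  measurable_fun setT f -> (forall x, 0 <= f x)%E ->
  (\int[leb]_x f (x + c)%R = \int[leb]_x f x)%E.
Proof.
move=> mf f0; pose phi (x : measurableTypeR R) : measurableTypeR R := x + c.
have mphi : measurable_fun setT phi by exact: measurable_funD.
have := @ge0_integral_pushforward _ _ _ _ R phi mphi leb setT f measurableT mf.
rewrite preimage_setT /= => <- //.
apply/esym/eq_measure_integral => //= A mA _.
apply: (lebesgue_measure_unique (mu :=
  measure_function_pushforward__canonical__measure_function_Measure leb mphi))
  => // _ [[a b]] _ <-.
rewrite /= /pushforward.
have -> : phi @^-1` `]a, b]%classic = `]a - c, b - c]%classic.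
  by apply/seteqP; split => x /=; rewrite /phi !in_itv/= ltrBlDr lerBrDr.
rewrite !lebesgue_measure_itv/= !lte_fin ltrD2r -!EFinD.
by case: ifP => // _; congr EFin; ring.
Qed.

Lemma integral_lebesgueN (f : R -> \bar R) :
  measurable_fun setT f -> (forall x, 0 <= f x)%E ->
  (\int[leb]_x f (- x)%R = \int[leb]_x f x)%E.
Proof.
move=> mf f0; pose phi (x : measurableTypeR R) : measurableTypeR R := - x.
have mphi : measurable_fun setT phi by exact: oppr_measurable.
have := @ge0_integral_pushforward _ _ _ _ R phi mphi leb setT f measurableT mf.
rewrite preimage_setT /= => <- //.
by apply: eq_measure_integral => //= A mA _; exact: lebesgue_measureN.
Qed.

Lemma measurable_rV_translation n (c : 'rV[R]_n) :
  measurable_fun setT (fun v : 'rV[R]_n => v + c).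
Proof.
apply: measurable_fun_rVP => i.
rewrite (_ : (fun _ => _) = fun v : 'rV[R]_n => v 0 i + c 0 i).
  by apply: measurable_funD => //; exact: measurable_coord.
by apply/funext => v; rewrite mxE.
Qed.

Lemma measurable_rV_opp n : measurable_fun setT (fun v : 'rV[R]_n => - v).
Proof.
apply: measurable_fun_rVP => i.
rewrite (_ : (fun _ => _) = (-%R : R -> R) \o (fun v : 'rV[R]_n => v 0 i)).
  by apply: measurableT_comp => //; exact: measurable_coord.
by apply/funext => v; rewrite mxE.
Qed.

Lemma vconsD n (x y : R) (v w : 'rV[R]_n) :
  vcons (x + y) (v + w) = vcons x v + vcons y w.
Proof.
by apply/rowP => i; rewrite !mxE; case: unliftP => [j _|_] //; rewrite mxE.
Qed.

Lemma vconsN n (x : R) (v : 'rV[R]_n) : vcons (- x) (- v) = - vcons x v.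
Proof.
by apply/rowP => i; rewrite !mxE; case: unliftP => [j _|_] //; rewrite mxE.
Qed.

Lemma vcons_head_tail n (v : 'rV[R]_n.+1) :
  v = vcons (v 0 ord0) (\row_j v 0 (lift ord0 j)).
Proof.
by apply/rowP => i; rewrite !mxE; case: unliftP => [j ->|->] //; rewrite mxE.
Qed.

(** Induction on the dimension: the head is translated on the line, the tail by the induction
    hypothesis. *)
Lemma integral_lebrV_translation n (c : 'rV[R]_n) (f : 'rV[R]_n -> \bar R) :
  measurable_fun setT f -> (forall v, 0 <= f v)%E ->
  (\int[lebrV n]_v f (v + c)%R = \int[lebrV n]_v f v)%E.
Proof.
elim: n => [|n IH] in c f *.
  by move=> mf f0; apply: eq_integral => v _; rewrite (thinmx0 c) addr0.
move=> mf f0; have mfc := measurableT_comp mf (measurable_rV_translation c).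
rewrite !integral_lebrVS//.
rewrite -[RHS](@integral_lebesgue_translation (c 0 ord0)); last 2 first.
- exact: measurable_integral_vcons.
- by move=> x; exact: integral_ge0.
apply: eq_integral => x _.
rewrite -[RHS](IH (\row_j c 0 (lift ord0 j))); last 2 first.
- exact: measurable_fun_vcons.
- by [].
by apply: eq_integral => v _; rewrite {1}(vcons_head_tail c) -vconsD.
Qed.

Lemma integral_lebrVN n (f : 'rV[R]_n -> \bar R) :
  measurable_fun setT f -> (forall v, 0 <= f v)%E ->
  (\int[lebrV n]_v f (- v)%R = \int[lebrV n]_v f v)%E.
Proof.
elim: n => [|n IH] in f *.
  by move=> mf f0; apply: eq_integral => v _; rewrite (thinmx0 v) oppr0.
move=> mf f0; have mfc := measurableT_comp mf (@measurable_rV_opp n.+1).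
rewrite !integral_lebrVS//.
rewrite -[RHS]integral_lebesgueN; last 2 first.
- exact: measurable_integral_vcons.
- by move=> x; exact: integral_ge0.
apply: eq_integral => x _.
rewrite -[RHS]IH; last 2 first.
- exact: measurable_fun_vcons.
- by [].
by apply: eq_integral => v _; rewrite -vconsN.
Qed.

End lebesgue_rV_theory.

Section measurable_comparison.
Context d (T : measurableType d) (R : realType).
Implicit Types f g : T -> R.

Lemma measurable_set_lt f g : measurable_fun setT f -> measurable_fun setT g ->
  measurable [set x | f x < g x].
Proof.
move=> mf mg.
have := measurable_fun_ltr mf mg measurableT (I : measurable [set true]).
by rewrite setTI.
Qed.

Lemma measurable_set_le f g : measurable_fun setT f -> measurable_fun setT g ->
  measurable [set x | f x <= g x].
Proof.
move=> mf mg.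
have := measurable_fun_ler mf mg measurableT (I : measurable [set true]).
by rewrite setTI.
Qed.

End measurable_comparison.

(** * Cubes and the Euclidean norm *)

Section cubes.
Variables (R : realType) (n : nat).
Implicit Types (x y v w : 'rV[R]_n) (r : R).

(** Open balls of the sup norm, with [r] half the side; their volumes and inclusions are explicit,
    unlike those of Euclidean balls. *)
Definition cube x r : set 'rV[R]_n := [set v | forall i, `|v 0 i - x 0 i| < r].

Lemma measurable_cube x r : measurable (cube x r).
Proof.
have -> : cube x r = \bigcap_(i in [set: 'I_n]) [set v : 'rV[R]_n | `|v 0 i - x 0 i| < r].
  by apply/seteqP; split => v /= h i; [move=> _|]; exact: h.
apply: fin_bigcap_measurable => // i _.
have mf : measurable_fun setT (fun v : 'rV[R]_n => `|v 0 i - x 0 i|).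
  apply: measurableT_comp => //; apply: measurable_funB => //.
  exact: measurable_coord.
exact: measurable_set_lt.
Qed.

Lemma nbhs_cubeP x (A : set 'rV[R]_n) :
  nbhs x A <-> exists2 e : R, 0 < e & cube x e `<=` A.
Proof.
split.
  move=> /nbhs_ballP[e /= e0 eA]; exists e => // v vx; apply: eA.
  by split => // i j; rewrite /ball/= ord1 distrC; exact: vx.
move=> [e e0 eA]; apply/nbhs_ballP; exists e => //= v [_ xv]; apply: eA => i.
by rewrite distrC; exact: xv.
Qed.

Lemma cube_center x r : 0 < r -> cube x r x.
Proof. by move=> r0 i; rewrite subrr normr0. Qed.

Lemma nbhs_cube x r : 0 < r -> nbhs x (cube x r).
Proof. by move=> r0; apply/nbhs_cubeP; exists r. Qed.

Lemma subset_cube x y r r' : (forall i, `|x 0 i - y 0 i| + r <= r') ->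
  cube x r `<=` cube y r'.
Proof.
move=> xy v vx i; apply: lt_le_trans (xy i).
rewrite -(subrKA (x 0 i)) addrC; apply: le_lt_trans (ler_normD _ _) _.
by rewrite ltrD2l.
Qed.

Lemma rat_approx_rV x e : 0 < e ->
  exists q : 'rV[rat]_n, forall i, `|x 0 i - ratr (q 0 i)| < e.
Proof.
move=> e0.
have /choice[q qx] : forall i, exists q : rat, `|x 0 i - ratr q| < e.
  move=> i; have /rat_in_itvoo[q] : x 0 i - e < x 0 i + e by lra.
  rewrite in_itv/= => /andP[h1 h2]; exists q.
  by rewrite ltr_distlC; apply/andP; split; lra.
by exists (\row_i q i) => i; rewrite mxE.
Qed.

(** An open set is the union of the countably many cubes with rational centre and radius [1 / k.+1]
    that it contains. *)
Lemma open_measurable_rV (A : set 'rV[R]_n) : open A -> measurable A.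
Proof.
move=> oA.
pose Q (qk : 'rV[rat]_n * nat) : set 'rV[R]_n :=
  cube (\row_i ratr (qk.1 0 i)) qk.2.+1%:R^-1.
have -> : A = \bigcup_(qk in setT) (if `[< Q qk `<=` A >] then Q qk else set0).
  apply/seteqP; split => x.
    move=> Ax; have /nbhs_cubeP[e e0 eA] : nbhs x A by exact: open_nbhs_nbhs.
    pose k := Num.truncn (2 / e).
    have ke : k.+1%:R^-1 < e / 2.
      rewrite -[ltRHS]invrK ltf_pV2 ?posrE//; last by rewrite invr_gt0 divr_gt0.
      by rewrite invf_div truncnS_gt.
    have [q qx] := @rat_approx_rV x k.+1%:R^-1 (ltac:(by rewrite invr_gt0)).
    exists (q, k) => //; case: ifPn => [_|/asboolPn[]].
      by move=> i /=; rewrite mxE.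
    apply: subset_trans eA; apply: subset_cube => i /=.
    rewrite mxE distrC; have := qx i; move: ke.
    by set a := _^-1; set b := `|_|; clearbody a b; lra.
  by move=> [qk _]; case: ifPn => // /asboolP QA /QA.
apply: countable_bigcupT_measurable => [|qk]; first exact: countableP.
by case: ifPn => _ //; exact: measurable_cube.
Qed.

End cubes.

Section lebrV_cube.
Variables (R : realType).

Lemma lebrV_cube n (x : 'rV[R]_n) (r : R) : 0 < r ->
  lebrV R n (cube x r) = ((2 * r) ^+ n)%:E.
Proof.
move=> r0; elim: n x => [|n IH] x.
  rewrite -lebd_lebrV; last exact: measurable_cube.
  rewrite /lebd/= indicE expr0 mem_set// => -[]//.
pose x' : 'rV[R]_n := \row_j x 0 (lift ord0 j).
have mI k (y : 'rV[R]_k) : measurable_fun setT (fun v => (\1_(cube y r) v)%:E : \bar R).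
  by apply/measurable_EFinP; apply: measurable_indic; exact: measurable_cube.
transitivity (\int[lebrV R n.+1]_v (\1_(cube x r) v)%:E)%E.
  by rewrite integral_indic ?setIT//; exact: measurable_cube.
rewrite integral_lebrVS//.
pose J := `](x 0 ord0 - r), (x 0 ord0 + r)[%classic.
have JE a : J a <-> `|a - x 0 ord0| < r.
  by rewrite /J/= in_itv/= ltr_distl.
have vE a v : \1_(cube x r) (vcons a v) =
    \1_J a * \1_(cube x' r) v :> R.
  rewrite !indicE -natrM mulnb; congr (_%:R); congr nat_of_bool.
  apply/idP/andP.
    move/set_mem => h; split; apply/mem_set.
      by apply/JE; have := h ord0; rewrite !mxE unlift_none.
    by move=> i; have := h (lift ord0 i); rewrite !mxE liftK.
  move=> [/set_mem/JE h1 /set_mem h2]; apply/mem_set => i.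
  case: (unliftP ord0 i) => [j ->|->].
    by have := h2 j; rewrite !mxE liftK.
  by rewrite !mxE unlift_none.
have inner a : (\int[lebrV R n]_v (\1_(cube x r) (vcons a v))%:E =
    ((2 * r) ^+ n)%:E * (\1_J a)%:E)%E.
  under eq_integral => v _ do rewrite vE EFinM.
  rewrite ge0_integralZl//; last exact: mI.
  rewrite muleC; congr (_ * _)%E.
  by rewrite integral_indic; [rewrite setIT; exact: IH| |exact: measurable_cube].
under eq_integral => a _ do rewrite inner.
rewrite ge0_integralZl//; last 2 first.
- by apply/measurable_EFinP; apply: measurable_indic; exact: measurable_itv.
- by rewrite lee_fin exprn_ge0// mulr_ge0// ltW.
have lebJ : lebesgue_measure J = (2 * r)%:E.
  rewrite lebesgue_measure_itv/= lte_fin ifT; last lra.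
  by rewrite -EFinD; congr EFin; ring.
rewrite integral_indic//; last exact: measurable_itv.
by rewrite setIT exprS EFinM muleC; congr (_ * _)%E.
Qed.

End lebrV_cube.

Section enorm_theory.
Variables (R : realType) (n : nat).
Implicit Types (x y v w : 'rV[R]_n) (r : R).

Definition dotv v w : R := \sum_(i < n) v 0 i * w 0 i.

Lemma dotvDl u v w : dotv (u + v) w = dotv u w + dotv v w.
Proof. by rewrite -big_split; apply: eq_bigr => i _; rewrite mxE mulrDl. Qed.

Lemma dotvZl a v w : dotv (a *: v) w = a * dotv v w.
Proof. by rewrite mulr_sumr; apply: eq_bigr => i _; rewrite mxE mulrA. Qed.

Lemma dotvC v w : dotv v w = dotv w v.
Proof. by apply: eq_bigr => i _; rewrite mulrC. Qed.

Lemma dotv_sqrD v w : dotv (v + w) (v + w) = dotv v v + 2 * dotv v w + dotv w w.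
Proof.
rewrite mulr_sumr -!big_split/=; apply: eq_bigr => i _; rewrite !mxE; ring.
Qed.

Lemma dotv_sqrB v w : dotv (v - w) (v - w) = dotv v v - 2 * dotv v w + dotv w w.
Proof.
rewrite mulr_sumr -sumrB -big_split/=; apply: eq_bigr => i _; rewrite !mxE; ring.
Qed.

Lemma enorm_sq v : enorm v ^+ 2 = dotv v v.
Proof.
rewrite /enorm sqr_sqrtr; last by apply: sumr_ge0 => i _; exact: sqr_ge0.
by apply: eq_bigr => i _; rewrite expr2.
Qed.

Lemma enorm_ge0 v : 0 <= enorm v.
Proof. exact: sqrtr_ge0. Qed.

Lemma enormZ a v : enorm (a *: v) = `|a| * enorm v.
Proof.
apply/eqP; rewrite -(@eqrXn2 _ 2) ?mulr_ge0 ?enorm_ge0//.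
rewrite exprMn !enorm_sq dotvZl dotvC dotvZl real_normK ?num_real//.
by rewrite mulrA expr2.
Qed.

Lemma enormN v : enorm (- v) = enorm v.
Proof. by rewrite -scaleN1r enormZ normrN1 mul1r. Qed.

Lemma enormB v w : enorm (v - w) = enorm (w - v).
Proof. by rewrite -enormN opprB. Qed.

Lemma coord_le_enorm v i : `|v 0 i| <= enorm v.
Proof.
rewrite -sqrtr_sqr ler_wsqrtr// (bigD1 i)//= lerDl.
by apply: sumr_ge0 => j _; exact: sqr_ge0.
Qed.

Lemma enorm_eq0 v : enorm v = 0 -> v = 0.
Proof.
move=> v0; apply/rowP => i; rewrite mxE; apply/eqP.
by rewrite -normr_le0 -v0 coord_le_enorm.
Qed.

(** The sum of squares gives the factor [n] under the root, and [n <= n ^+ 2]. *)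
Lemma enorm_le v c : 0 <= c -> (forall i, `|v 0 i| <= c) -> enorm v <= n%:R * c.
Proof.
move=> c0 vc; rewrite -(ler_pXn2r (ltn0Sn 1)) ?nnegrE ?enorm_ge0 ?mulr_ge0//.
rewrite enorm_sq (@le_trans _ _ (\sum_(i < n) c ^+ 2))//.
  apply: ler_sum => i _; rewrite -expr2 -real_normK ?num_real//.
  by rewrite lerXn2r ?nnegrE.
rewrite sumr_const card_ord exprMn -[leLHS]mulr_natl ler_wpM2r ?sqr_ge0//.
by rewrite -natrX ler_nat; case: (n) => // m; rewrite leq_pmulr.
Qed.

Lemma measurable_enorm x : measurable_fun setT (fun v => enorm (v - x)).
Proof.
have msqrt : measurable_fun setT (@Num.sqrt R).
  exact: continuous_measurable_fun (@sqrt_continuous R).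
apply: (measurableT_comp msqrt); apply: measurable_sum => i; apply: measurable_funX.
rewrite (_ : (fun _ => _) = fun v : 'rV[R]_n => v 0 i - x 0 i).
  by apply: measurable_funB => //; exact: measurable_coord.
by apply/funext => v; rewrite !mxE.
Qed.

Lemma continuous_enorm x : continuous (fun v => enorm (v - x)).
Proof.
move=> v; apply: (@continuous_comp _ _ _ (fun v => \sum_(i < n) (v - x) 0 i ^+ 2)
  (@Num.sqrt R)); last exact: sqrt_continuous.
elim: (index_enum _) => [|i s IH].
  have -> : (fun v => \sum_(i <- [::]) (v - x) 0 i ^+ 2) = (fun=> 0).
    by apply/funext => w; rewrite big_nil.
  exact: cst_continuous.
have -> : (fun v => \sum_(i <- i :: s) (v - x) 0 i ^+ 2) =
    (fun v => (v 0 i - x 0 i) ^+ 2 + \sum_(i <- s) (v - x) 0 i ^+ 2).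
  by apply/funext => w; rewrite big_cons !mxE.
apply: continuousD => //.
apply: (@continuous_comp _ _ _ (fun v : 'rV[R]_n => v 0 i - x 0 i) (fun t => t ^+ 2)).
  by apply: continuousB; [exact: coord_continuous|exact: cst_continuous].
exact: exprn_continuous.
Qed.

Lemma measurable_eball x r : measurable (eball x r).
Proof.
apply: measurable_set_lt => //; exact: measurable_enorm.
Qed.

Lemma eball_sub_cube x r : eball x r `<=` cube x r.
Proof.
move=> v xv i; apply: le_lt_trans xv.
by apply: le_trans (coord_le_enorm _ i); rewrite !mxE.
Qed.

End enorm_theory.

(** * Points of low density *)

Section covering.
Variables (R : realType) (n : nat).
Local Notation la := (lebrV R n).
Implicit Types (x y v w : 'rV[R]_n) (r : R).

Lemma le_lebrV (A B : set 'rV[R]_n) :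
  measurable A -> measurable B -> A `<=` B -> (la A <= la B)%E.
Proof. by move=> mA mB; apply: le_measure; rewrite inE. Qed.

Definition cubes (s : seq ('rV[R]_n * R)) : set 'rV[R]_n :=
  [set v | exists2 b, b \in s & cube b.1 b.2 v].

Lemma cubes_cons b s : cubes (b :: s) = cube b.1 b.2 `|` cubes s.
Proof.
apply/seteqP; split => v.
  move=> [c]; rewrite inE => /predU1P[->|cs cv]; [by left|by right; exists c].
move=> [bv|[c cs cv]]; first by exists b => //; rewrite mem_head.
by exists c => //; rewrite inE cs orbT.
Qed.

Lemma measurable_cubes s : measurable (cubes s).
Proof.
elim: s => [|b s IH]; last first.
  by rewrite cubes_cons; apply: measurableU => //; exact: measurable_cube.
by rewrite (_ : cubes [::] = set0)//; apply/seteqP; split => // v [b].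
Qed.

Lemma subset_cubes s s' : {subset s <= s'} -> cubes s `<=` cubes s'.
Proof. by move=> ss' v [b bs bv]; exists b => //; exact: ss'. Qed.

Lemma exists_max_radius (s : seq ('rV[R]_n * R)) : s != [::] ->
  exists2 b, b \in s & forall c, c \in s -> c.2 <= b.2.
Proof.
elim: s => // b s IH _; have [->|/IH[c cs cmax]] := eqVneq s [::].
  by exists b => [|c]; rewrite inE// => /eqP ->.
have [cb|bc] := leP c.2 b.2.
  exists b; first by rewrite mem_head.
  by move=> a; rewrite inE => /predU1P[->//|/cmax/le_trans]; apply.
exists c; first by rewrite inE cs orbT.
by move=> a; rewrite inE => /predU1P[->|/cmax//]; exact: ltW.
Qed.

(* Vitali's greedy selection: keep a cube of maximal radius, discard the cubes
   that meet it (its threefold enlargement contains them), and iterate. *)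
Lemma vitali_lebrV (E : set 'rV[R]_n) (eta : R) s :
  measurable E -> 0 <= eta ->
  (forall b, b \in s -> 0 < b.2 /\ ((eta * b.2 ^+ n)%:E <= la (E `&` cube b.1 b.2))%E) ->
  (eta%:E * la (cubes s) <= (6 ^+ n)%:E * la (E `&` cubes s))%E.
Proof.
move=> mE eta0; have [m] := ubnP (size s); elim: m s => // m IH s.
rewrite ltnS => sm hs.
have [s0|/exists_max_radius[b bs bmax]] := eqVneq s [::].
  rewrite s0 (_ : cubes [::] = set0); last by apply/seteqP; split => // v [].
  by rewrite setI0 !measure0 !mule0.
have [b0 hb] := hs b bs.
pose s' := [seq c <- s | `[< cube c.1 c.2 `&` cube b.1 b.2 = set0 >]].
have s's : {subset s' <= s} by move=> c; rewrite mem_filter => /andP[].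
(* [b] meets itself, so it is discarded and the list gets shorter. *)
have sizes' : (size s' < m)%N.
  apply: leq_trans sm.
  rewrite -(count_predC (fun c => `[< cube c.1 c.2 `&` cube b.1 b.2 = set0 >]) s).
  rewrite size_filter -addn1 leq_add2l -has_count; apply/hasP; exists b => //=.
  apply/asboolPn => /seteqP[/(_ b.1) + _]; apply.
  by split; exact: cube_center.
have IHs' := IH _ sizes' (fun c cs' => hs c (s's c cs')).
have mb := measurable_cube b.1 b.2; have mb3 := measurable_cube b.1 (3 * b.2).
have ms' := measurable_cubes s'; have ms := measurable_cubes s.
have dis : cube b.1 b.2 `&` cubes s' = set0.
  apply/seteqP; split => // v [bv [c]]; rewrite mem_filter => /andP[/asboolP h _] cv.
  by rewrite -h.
have cov : cubes s `<=` cube b.1 (3 * b.2) `|` cubes s'.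
  move=> v [c cs cv].
  have [cb|] := pselect (cube c.1 c.2 `&` cube b.1 b.2 = set0).
    by right; exists c => //; rewrite mem_filter cs andbT; exact/asboolP.
  move=> /eqP/set0P[w [cw bw]]; left => i.
  have := cv i; have := cw i; have := bw i; have := bmax _ cs.
  rewrite !ltr_norml => ? /andP[? ?] /andP[? ?] /andP[? ?].
  by apply/andP; split; lra.
apply: (@le_trans _ _ (eta%:E * (la (cube b.1 (3 * b.2)) + la (cubes s')))%E).
  apply: lee_wpmul2l; first by rewrite lee_fin.
  apply: le_trans (measureU2 _ mb3 ms'); apply: le_lebrV => //.
  exact: measurableU.
rewrite ge0_muleDr//.
apply: (@le_trans _ _ ((6 ^+ n)%:E * la (E `&` cube b.1 b.2) +
    (6 ^+ n)%:E * la (E `&` cubes s'))%E).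
  apply: leeD => //.
  (* The tripled cube has side [6 * b.2], whence the factor [6 ^+ n]. *)
  have -> : (eta%:E * la (cube b.1 (3 * b.2)) = (6 ^+ n)%:E * (eta * b.2 ^+ n)%:E)%E.
    rewrite lebrV_cube ?mulr_gt0// -!EFinM; congr EFin.
    rewrite mulrA (_ : 2 * 3 = 6); last by ring.
    by rewrite exprMn mulrCA.
  by apply: lee_wpmul2l => //; rewrite lee_fin exprn_ge0.
rewrite -ge0_muleDr//; apply: lee_wpmul2l; first by rewrite lee_fin exprn_ge0.
rewrite -measureU; [|exact: measurableI|exact: measurableI|].
  apply: le_lebrV; [by apply: measurableU; exact: measurableI|exact: measurableI|].
  move=> v [] [Ev]; first by split => //; exists b.
  by move/(subset_cubes s's).
by rewrite setIACA dis setI0.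
Qed.

(** Otherwise each point of the closed cube of radius [a] is the centre of a cube, of radius at most
    [rho], where [E] has density at least [eta]. By compactness finitely many of these cover, and
    [vitali_lebrV] then gives [E] too much mass in [cube 0 (a + rho)]. *)
Lemma exists_low_density (E : set 'rV[R]_n) (a rho eta : R) :
  measurable E -> 0 < a -> 0 <= eta ->
  ((6 ^+ n)%:E * la (E `&` cube 0 (a + rho)) < (eta * (2 * a) ^+ n)%:E)%E ->
  exists z : 'rV[R]_n, (forall i, `|z 0 i| <= a) /\
    forall r, 0 < r -> r <= rho -> (la (E `&` cube z r) < (eta * r ^+ n)%:E)%E.
Proof.
move=> mE a0 eta0; apply: contraPP => /forallNP nz; apply/negP; rewrite -leNgt.
pose K : set 'rV[R]_n := [set v | forall i, v ord0 i \in `[- a, a]].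
have KE z : K z -> forall i, `|z 0 i| <= a.
  by move=> Kz i; rewrite ler_norml; have := Kz i; rewrite in_itv.
have cK : compact K.
  by apply: (@rV_compact R n (fun=> `[- a, a]%classic)) => _; exact: segment_compact.
have /choice[f fP] : forall z, exists r, K z ->
    [/\ 0 < r, r <= rho & ((eta * r ^+ n)%:E <= la (E `&` cube z r))%E].
  move=> z; have [Kz|] := pselect (K z); last by exists 0.
  have := nz z; rewrite not_andE => -[/(_ (KE z Kz))//|].
  move=> /existsNP[r /not_implyP[r0 /not_implyP[rr /negP]]].
  by rewrite -leNgt => h; exists r => _; split.
move: cK; rewrite compact_cover => /(_ _ K (fun z => interior (cube z (f z)))).
case=> [z _|z Kz|D' D'K KD'].
- exact: open_interior.
- exists z => //; have [f0 _ _] := fP z Kz; exact: nbhs_cube.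
pose s : seq ('rV[R]_n * R) := [seq (z, f z) | z <- finmap.enum_fset D'].
have sK b : b \in s -> K b.1 /\ b.2 = f b.1.
  by move=> /mapP[z /D'K zD ->]; split => //=; exact: set_mem.
have /(vitali_lebrV mE eta0) V : forall b, b \in s ->
    0 < b.2 /\ ((eta * b.2 ^+ n)%:E <= la (E `&` cube b.1 b.2))%E.
  by move=> b /sK[/fP[? ? ?] ->]; split.
have c1 : (la (cube 0 a) <= la (cubes s))%E.
  apply: le_lebrV; [exact: measurable_cube|exact: measurable_cubes|].
  move=> v va; have /KD'[z zD zv] : K v.
    move=> i; have := va i; rewrite mxE subr0 in_itv/= ltr_norml.
    by move=> /andP[/ltW -> /ltW ->].
  exists (z, f z); first by apply/mapP; exists z.
  exact: interior_subset zv.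
have c2 : (la (E `&` cubes s) <= la (E `&` cube 0 (a + rho)))%E.
  apply: le_lebrV.
  - by apply: measurableI => //; exact: measurable_cubes.
  - by apply: measurableI => //; exact: measurable_cube.
  - move=> v [Ev [b /sK[Kb bf] bv]]; split => //.
    apply: subset_cube bv => i; rewrite mxE subr0 lerD ?KE// bf.
    by have [] := fP _ Kb.
rewrite EFinM -(lebrV_cube 0 a0).
apply: (@le_trans _ _ (eta%:E * la (cubes s))%E).
  by apply: lee_wpmul2l => //; rewrite lee_fin.
by apply: (le_trans V); apply: lee_wpmul2l => //; rewrite lee_fin exprn_ge0.
Qed.

End covering.

(** * Volume of the region between two tangent balls *)

Section slab.
Variables (R : realType) (n : nat).
Local Notation la := (lebrV R n).
Implicit Types (x y v w : 'rV[R]_n) (r : R).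

Lemma lebrV_translation (A : set 'rV[R]_n) (c : 'rV[R]_n) : measurable A ->
  la [set v | A (v + c)] = la A.
Proof.
move=> mA.
have mAc : measurable [set v | A (v + c)].
  by rewrite -[X in measurable X]setTI; exact: measurable_rV_translation.
have mI : measurable_fun setT (fun v => (\1_A v)%:E : \bar R).
  exact/measurable_EFinP/measurable_indic.
have laE (B : set 'rV[R]_n) : measurable B -> la B = (\int[la]_v (\1_B v)%:E)%E.
  by move=> mB; rewrite integral_indic ?setIT.
by rewrite !laE// -(integral_lebrV_translation c mI).
Qed.

Lemma integral_lebrV_reflection (c : 'rV[R]_n) (f : 'rV[R]_n -> \bar R) :
  measurable_fun setT f -> (forall v, 0 <= f v)%E ->
  (\int[la]_v f (c - v)%R = \int[la]_v f v)%E.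
Proof.
move=> mf f0; rewrite -[RHS](integral_lebrV_translation c)//.
rewrite -[RHS]integral_lebrVN//; last first.
  exact: measurableT_comp mf (measurable_rV_translation c).
by apply: eq_integral => v _; rewrite addrC.
Qed.

Lemma measurable_dotv y u : measurable_fun setT (fun w => dotv (w - y) u).
Proof.
apply: measurable_sum => i; apply: measurable_funM => //.
rewrite (_ : (fun _ => _) = fun v : 'rV[R]_n => v 0 i - y 0 i).
  by apply: measurable_funB => //; exact: measurable_coord.
by apply/funext => v; rewrite !mxE.
Qed.

(** Contains every point of [eball y r] outside both balls of radius [enorm u] centred at [y + u]
    and [y - u]: for such [w], twice the absolute value of [dotv (w - y) u] is at most
    [enorm (w - y) ^+ 2]. *)
Definition slab y u r : set 'rV[R]_n :=
  [set w | enorm (w - y) < r /\ `|dotv (w - y) u| <= r ^+ 2 / 2].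

Lemma measurable_slab y u r : measurable (slab y u r).
Proof.
apply: measurableI.
  by apply: measurable_set_lt => //; exact: measurable_enorm.
apply: measurable_set_le => //; apply: measurableT_comp => //.
exact: measurable_dotv.
Qed.

(* About [enorm u / (2 r)] translates of the slab along [u] are disjoint and fit
   in a cube of side [4 r]. *)
Lemma lebrV_slab y u r : 0 < r -> 0 < enorm u ->
  (la (slab y u r) <= ((4 * r) ^+ n * (2 * r / enorm u))%:E)%E.
Proof.
move=> r0 u0; set t := enorm u in u0 *.
(* Translation by [c *: u] changes [dotv (w - y) u] by [2 * r ^+ 2], which exceeds the width
   [r ^+ 2] of the slab; for [j < N] the total displacement is at most [r]. *)
pose c : R := 2 * r ^+ 2 / t ^+ 2.
pose N := (Num.truncn (t / (2 * r))).+1.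
have Nt : t / (2 * r) < N%:R by rewrite truncnS_gt.
pose S (j : nat) := [set w | slab y u r (w + (- (j%:R * c)) *: u)].
have mS j : measurable (S j).
  rewrite -[X in measurable X]setTI.
  by apply: measurable_rV_translation => //; exact: measurable_slab.
have Sdot j w : S j w -> `|dotv (w - y) u - 2 * j%:R * r ^+ 2| <= r ^+ 2 / 2.
  move=> [_ /=]; rewrite (addrAC w) (dotvDl (w - y)) dotvZl -enorm_sq -/t.
  rewrite (_ : - (j%:R * c) * t ^+ 2 = - (2 * j%:R * r ^+ 2))//.
  by rewrite /c; field; rewrite gt_eqF.
have dis : trivIset `I_N S.
  have disj i j w : (i < j)%N -> S i w -> S j w -> False.
    move=> ij /Sdot + /Sdot; rewrite !ler_norml => /andP[_ h1] /andP[h2 _].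
    have r20 : 0 < r ^+ 2 by rewrite exprn_gt0.
    have : i%:R + 1 <= j%:R :> R by rewrite natr1 ler_nat.
    move=> /(ler_wpM2r (ltW r20)); rewrite mulrDl mul1r.
    move: h1 h2; rewrite -!mulrA; set a := i%:R * _; set b := j%:R * _.
    by clearbody a b; lra.
  move=> i j _ _ [w [Si Sj]]; case: (ltngtP i j) => // ij.
    by have := disj _ _ _ ij Si Sj.
  by have := disj _ _ _ ij Sj Si.
have sub : \big[setU/set0]_(j < N) S j `<=` cube y (2 * r).
  rewrite -bigcup_mkord => w [j /= jN [Sj _]] i.
  have jr : j%:R * c * t <= r.
    have : j%:R <= t / (2 * r).
      apply: (@le_trans _ _ (Num.truncn (t / (2 * r)))%:R).
        by rewrite ler_nat -ltnS.
      by rewrite truncn_le divr_ge0 ?mulr_ge0 ?ltW.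
    move=> /(ler_wpM2r (ltW r0)) jr.
    rewrite (_ : _ * t = 2 * r / t * (j%:R * r)); last first.
      by rewrite /c; field; rewrite gt_eqF.
    apply: (@le_trans _ _ (2 * r / t * (t / (2 * r) * r))).
      by rewrite ler_wpM2l// divr_ge0 ?mulr_ge0 ?ltW.
    rewrite le_eqVlt; apply/orP; left; apply/eqP; field.
    by rewrite !gt_eqF ?mulr_gt0.
  have h1 : `|(w + (- (j%:R * c)) *: u - y) 0 i| < r.
    exact: le_lt_trans (coord_le_enorm _ _) Sj.
  have h2 : `|j%:R * c * u 0 i| <= r.
    apply: le_trans jr; rewrite normrM ger0_norm; last first.
      by rewrite mulr_ge0// divr_ge0 ?mulr_ge0 ?exprn_ge0 ?ltW.
    rewrite ler_wpM2l ?coord_le_enorm//.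
    by rewrite mulr_ge0// divr_ge0 ?mulr_ge0 ?exprn_ge0 ?ltW.
  move: h1 h2; rewrite !mxE !ltr_norml !ler_norml.
  set a := j%:R * c * _; rewrite (_ : - (j%:R * c) * u 0 i = - a); last by rewrite mulNr.
  by clearbody a => /andP[? ?] /andP[? ?]; apply/andP; split; lra.
have mU : measurable (\big[setU/set0]_(j < N) S j).
  by apply: bigsetU_measurable.
have /le_lebrV := sub => /(_ mU (measurable_cube _ _)).
have -> : la (\big[setU/set0]_(j < N) S j) = (\sum_(j < N) la (slab y u r))%E.
  transitivity (\sum_(j < N) la (S j))%E.
    exact: measure_semi_additive_ord_I.
  by apply: eq_bigr => j _; rewrite lebrV_translation//; exact: measurable_slab.
rewrite lebrV_cube ?mulr_gt0//.
rewrite (_ : 2 * (2 * r) = 4 * r); last by ring.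
have la_fin : la (slab y u r) \is a fin_num.
  rewrite ge0_fin_numE//; apply: (@le_lt_trans _ _ (la (cube y r))).
    apply: le_lebrV; [exact: measurable_slab|exact: measurable_cube|].
    by move=> w [+ _]; exact: eball_sub_cube.
  by rewrite lebrV_cube// ltry.
rewrite -(fineK la_fin) sumEFin !lee_fin sumr_const card_ord -[_ *+ N]mulr_natl => h.
have x0 : 0 <= fine (la (slab y u r)) by rewrite fine_ge0.
have h' : t / (2 * r) * fine (la (slab y u r)) <= (4 * r) ^+ n.
  by apply: le_trans h; rewrite ler_wpM2r// ltW.
have -> : fine (la (slab y u r)) = 2 * r / t * (t / (2 * r) * fine (la (slab y u r))).
  by field; rewrite !gt_eqF ?mulr_gt0.
by rewrite [leRHS]mulrC ler_wpM2l// divr_ge0 ?mulr_ge0// ltW.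
Qed.

End slab.

(** * Integrals of the kernel *)

Section series_bound.
Context d (T : measurableType d) (R : realType).
Variable mu : {measure set T -> \bar R}.

Lemma nneseries_geometric_le (a r : R) : 0 <= a -> 0 < r < 1 ->
  (\sum_(0 <= j <oo) (a * r ^+ j)%:E <= (a / (1 - r))%:E)%E.
Proof.
move=> a0 /andP[r0 r1]; apply: lime_le.
  apply: is_cvg_nneseries => j _ _.
  by rewrite lee_fin mulr_ge0// exprn_ge0// ltW.
apply: nearW => N; rewrite sumEFin lee_fin.
have := @geometric_le_lim R N a r a0 r0; rewrite (ger0_norm (ltW r0)) => /(_ r1).
by rewrite /series/=.
Qed.

(** The integrand is dominated by the series of the step functions [c j * \1_(B j)], integrated term
    by term. This reduces each dyadic decomposition below to a geometric series. *)
Lemma le_integral_geometric (A : set T) (k : T -> R) (B : nat -> set T)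
    (c : nat -> R) (a r : R) :
  measurable A -> measurable_fun setT k -> (forall x, 0 <= k x) ->
  (forall j, measurable (B j)) -> (forall j, 0 <= c j) ->
  0 <= a -> 0 < r < 1 ->
  (forall x, A x -> exists j, B j x /\ k x <= c j) ->
  (forall j, (c j)%:E * mu (B j) <= (a * r ^+ j)%:E)%E ->
  (\int[mu]_(x in A) (k x)%:E <= (a / (1 - r))%:E)%E.
Proof.
move=> mA mk k0 mB c0 a0 r01 AB cB.
pose f j x := (c j * \1_(B j) x)%:E.
have f0 j x : (0 <= f j x)%E by rewrite lee_fin mulr_ge0.
have mf j : measurable_fun A (f j).
  by apply: measurable_funTS; apply/measurable_EFinP; exact: measurable_funM.
apply: (@le_trans _ _ (\int[mu]_(x in A) \sum_(0 <= j <oo) f j x)%E).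
  apply: ge0_le_integral => //.
  - by move=> x _; rewrite lee_fin.
  - exact/measurable_EFinP/measurable_funTS.
  - apply: ge0_emeasurable_sum => //.
  (* The partial sum of length [j.+1] is the first to include the term of index [j], which alone
     dominates [k x]. *)
  - move=> x /AB[j [Bj kc]].
    apply: le_trans (nneseries_lim_ge j.+1 _) => //.
    rewrite big_nat_recr//=; apply: (@le_trans _ _ (f j x)).
      by rewrite /f indicE mem_set// mulr1 lee_fin.
    by rewrite leeDr// sume_ge0.
rewrite integral_nneseries//.
apply: le_trans (nneseries_geometric_le a0 r01); apply: lee_nneseries => [j _ _|j _].
  exact: integral_ge0.
apply: le_trans (cB j); under eq_integral do rewrite /f EFinM.
rewrite ge0_integralZl//; last 2 first.
- by apply: measurable_funTS; apply/measurable_EFinP; exact: measurable_indic.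
- by rewrite lee_fin.
rewrite integral_indic//; apply: lee_wpmul2l; first by rewrite lee_fin.
by apply: le_measure; rewrite ?inE//; exact: measurableI.
Qed.

End series_bound.

(** * Dyadic scales and real powers *)

Section dyadic.
Variable R : realType.
Implicit Types x delta : R.

Lemma dyadic_ge x delta : 0 < delta -> delta <= x ->
  exists j, delta * 2 ^+ j <= x < delta * 2 ^+ j.+1.
Proof.
move=> d0 dx.
have ex : exists j, x < delta * 2 ^+ j.
  exists (Num.truncn (x / delta)).+1.
  have := truncnS_gt (x / delta); rewrite ltr_pdivrMr// mulrC => /lt_le_trans; apply.
  by rewrite ler_pM2l// -natrX ler_nat ltnW// ltn_expl.
case: (ex_minnP ex) => [[|j]].
  by rewrite expr0 mulr1 ltNge dx.
move=> h hmin; exists j; rewrite h andbT leNgt; apply/negP => /hmin.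
by rewrite ltnn.
Qed.

Lemma dyadic_lt x delta : 0 < x -> x < delta ->
  exists j, delta * 2^-1 ^+ j.+1 <= x < delta * 2^-1 ^+ j.
Proof.
move=> x0 xd; have d0 := lt_trans x0 xd.
have ex : exists j, delta * 2^-1 ^+ j <= x.
  exists (Num.truncn (delta / x)).+1.
  have := truncnS_gt (delta / x); rewrite ltr_pdivrMr// => h.
  rewrite exprVn ler_pdivrMr ?exprn_gt0// mulrC.
  by apply: (le_trans (ltW h)); rewrite ler_pM2r// -natrX ler_nat ltnW// ltn_expl.
case: (ex_minnP ex) => [[|j]].
  by rewrite expr0 mulr1 leNgt xd.
move=> h hmin; exists j; rewrite h/= ltNge; apply/negP => /hmin.
by rewrite ltnn.
Qed.

Lemma powR_mul_expr delta (a s : R) j : 0 < delta -> 0 < a ->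
  (delta * a ^+ j) `^ s = delta `^ s * (a `^ s) ^+ j.
Proof.
move=> d0 a0; rewrite powRM ?exprn_ge0 ?ltW//; congr (_ * _).
by rewrite -powR_mulrn ?ltW// -powRrM mulrC powRrM powR_mulrn ?powR_ge0.
Qed.

(** The kernel at distance [x] times a volume of scale [x]: the scaling behind all the kernel
    estimates. *)
Lemma powR_nat_add x (m : nat) (s : R) : 0 < x ->
  x `^ (- (m%:R + s)) * x ^+ m = x `^ (- s).
Proof.
move=> x0; rewrite -powR_mulrn ?ltW// -powRD; last by apply/implyP => _; rewrite gt_eqF.
by congr powR; ring.
Qed.

Lemma ler_powRN x delta (p : R) : 0 < p -> 0 < delta -> delta <= x ->
  x `^ (- p) <= delta `^ (- p).
Proof.
move=> p0 d0 dx; have x0 := lt_le_trans d0 dx.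
rewrite !powRN lef_pV2 ?posrE ?powR_gt0//.
by apply: ge0_ler_powR; rewrite ?nnegrE// ltW.
Qed.

Lemma powR_lt1 (a s : R) : 0 < a < 1 -> 0 < s -> 0 < a `^ s < 1.
Proof.
move=> /andP[a0 a1] s0; rewrite powR_gt0//=.
have -> : 1 = 1 `^ s :> R by rewrite powR1.
by apply: gt0_ltr_powR => //; rewrite nnegrE ?ltW.
Qed.

End dyadic.

Section kernel.
Variables (R : realType) (n : nat) (s : R).
Hypothesis s01 : 0 < s < 1.
Local Notation la := (lebrV R n).
Local Notation p := (n%:R + s).
Implicit Types (y z w u : 'rV[R]_n) (delta eta t : R).

Let s0 : 0 < s. Proof. by case/andP: s01. Qed.
Let p0 : 0 < p. Proof. by rewrite ltr_wpDl. Qed.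

(* Equal to [0] at [w = y]. *)
Definition frac_ker y w : R := enorm (w - y) `^ (- p).

Lemma frac_ker_ge0 y w : 0 <= frac_ker y w.
Proof. exact: powR_ge0. Qed.

Lemma measurable_frac_ker y : measurable_fun setT (frac_ker y).
Proof.
exact: (measurableT_comp (measurable_powR (- p)) (measurable_enorm y)).
Qed.

Definition far y delta : set 'rV[R]_n := [set w | delta <= enorm (w - y)].

Lemma measurable_far y delta : measurable (far y delta).
Proof. by apply: measurable_set_le => //; exact: measurable_enorm. Qed.

(* The square root of the dyadic decay factor [2 `^ (- s)]: one half of the decay
   pays for the growth of the densities allowed in [thin_at], the other sums. *)
Definition far_ratio : R := 2^-1 `^ (s / 2).

Lemma far_ratio01 : 0 < far_ratio < 1.
Proof. by apply: powR_lt1; [lra|have := s0; lra]. Qed.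

Lemma far_ratio_sqr : far_ratio ^+ 2 = 2 `^ (- s).
Proof.
rewrite -powR_mulrn ?powR_ge0// /far_ratio -{1}[2^-1]powR_inv1// -!powRrM.
by congr powR; field.
Qed.

(** On the shell of index [j] the kernel times the volume scale decays like [far_ratio ^+ (2 * j)];
    the allowed density costs one factor [far_ratio ^+ j], and the other one makes the sum
    converge. *)
Lemma integral_far_le (E : set 'rV[R]_n) y delta theta :
  measurable E -> 0 < delta -> 0 <= theta ->
  (forall j, la (E `&` cube y (delta * 2 ^+ j.+1)) <=
     (theta / far_ratio ^+ j * (delta * 2 ^+ j.+1) ^+ n)%:E)%E ->
  (\int[la]_(w in E `&` far y delta) (frac_ker y w)%:E <=
     (theta * 2 ^+ n * delta `^ (- s) / (1 - far_ratio))%:E)%E.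
Proof.
move=> mE d0 t0 hE; have [r0 _] := andP far_ratio01.
apply: (@le_integral_geometric _ _ _ _ _ _ (fun j => E `&` cube y (delta * 2 ^+ j.+1))
   (fun j => (delta * 2 ^+ j) `^ (- p))).
- by apply: measurableI => //; exact: measurable_far.
- exact: measurable_frac_ker.
- exact: frac_ker_ge0.
- by move=> j; apply: measurableI => //; exact: measurable_cube.
- by move=> j; exact: powR_ge0.
- by rewrite !mulr_ge0 ?exprn_ge0 ?powR_ge0.
- exact: far_ratio01.
- move=> w [Ew /= dw]; have [j /andP[h1 h2]] := dyadic_ge d0 dw.
  exists j; split; first by split => //; exact: eball_sub_cube.
  by apply: ler_powRN => //; rewrite mulr_gt0 ?exprn_gt0.
- move=> j; have x0 : 0 < delta * 2 ^+ j by rewrite mulr_gt0 ?exprn_gt0.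
  apply: le_trans (lee_wpmul2l _ (hE j)) _; first by rewrite lee_fin powR_ge0.
  rewrite -EFinM lee_fin le_eqVlt; apply/orP; left; apply/eqP.
  rewrite exprS (mulrCA delta) exprMn.
  transitivity (theta * 2 ^+ n / far_ratio ^+ j *
    ((delta * 2 ^+ j) `^ (- p) * (delta * 2 ^+ j) ^+ n)); first by ring.
  rewrite powR_nat_add// powR_mul_expr// -far_ratio_sqr -exprM mulnC exprM.
  by field; rewrite expf_neq0// gt_eqF.
Qed.

(** A single cube of size [delta], at distance comparable with [delta] from [y], already contributes
    this much. *)
Lemma integral_far_ge y delta : (0 < n)%N -> 0 < delta ->
  ((2 ^+ n * (3 * n%:R) `^ (- p) * delta `^ (- s))%:E <=
   \int[la]_(w in far y delta) (frac_ker y w)%:E)%E.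
Proof.
move=> n0 d0.
(* The diagonal shift puts every coordinate of [w - y] between [delta] and [3 * delta], which bounds
   the norm on both sides. *)
pose c : 'rV[R]_n := y + const_mx (2 * delta).
have cf w : cube c delta w -> delta <= enorm (w - y) <= 3 * n%:R * delta.
  move=> cw; have h i : delta < w 0 i - y 0 i < 3 * delta.
    by have := cw i; rewrite !mxE ltr_norml => /andP[? ?]; apply/andP; split; lra.
  apply/andP; split.
    apply: le_trans (coord_le_enorm _ (Ordinal n0)); rewrite !mxE.
    by apply: le_trans (ler_norm _); have /andP[/ltW] := h (Ordinal n0).
  rewrite (mulrC 3) -mulrA; apply: enorm_le; first by rewrite mulr_ge0// ltW.
  move=> i; rewrite !mxE ler_norml; have /andP[h1 h2] := h i.
  by apply/andP; split; lra.
have mc := measurable_cube c delta.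
have N0 : 0 < 3 * n%:R :> R by rewrite mulr_gt0// ltr0n.
apply: (@le_trans _ _ (\int[la]_(w in cube c delta) (((3 * n%:R * delta) `^ (- p))%:E))%E).
  rewrite integral_cst// (_ : _ (cube c delta) = ((2 * delta) ^+ n)%:E);
    last exact: lebrV_cube.
  rewrite -EFinM lee_fin.
  rewrite (powRM _ (ltW N0) (ltW d0)) exprMn le_eqVlt; apply/orP; left; apply/eqP.
  transitivity (2 ^+ n * (3 * n%:R) `^ (- p) * (delta `^ (- p) * delta ^+ n)); last by ring.
  by rewrite powR_nat_add.
apply: (@le_trans _ _ (\int[la]_(w in cube c delta) (frac_ker y w)%:E)%E).
  apply: ge0_le_integral => //.
  - by move=> w _; rewrite lee_fin powR_ge0.
  - by apply/measurable_EFinP/measurable_funTS; exact: measurable_frac_ker.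
  - move=> w /cf/andP[h1 h2]; rewrite lee_fin; apply: ler_powRN => //.
    exact: lt_le_trans h1.
apply: ge0_subset_integral => //.
- exact: measurable_far.
- by apply/measurable_EFinP/measurable_funTS; exact: measurable_frac_ker.
- by move=> w _; rewrite lee_fin frac_ker_ge0.
- by move=> w /cf/andP[].
Qed.

(** The decay of the near integral when the scale is halved; it is below one because [s < 1]. *)
Definition near_ratio : R := 2^-1 `^ (1 - s).

Lemma near_ratio01 : 0 < near_ratio < 1.
Proof. by apply: powR_lt1; [lra|case/andP: s01; lra]. Qed.

(** At scale [x] the slab has volume of order [x ^+ n.+1 / enorm u]; against the kernel this leaves
    [x] to the power [1 - s] over [enorm u], summable over the scales shrinking to [y]. *)
Lemma integral_slab_le y u (A : set 'rV[R]_n) delta :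
  measurable A -> 0 < delta -> 0 < enorm u ->
  (forall w, A w -> 0 < enorm (w - y) < delta /\
     2 * `|dotv (w - y) u| <= enorm (w - y) ^+ 2) ->
  (\int[la]_(w in A) (frac_ker y w)%:E <=
    (2 * 2 `^ p * 4 ^+ n * (delta / enorm u) * delta `^ (- s) / (1 - near_ratio))%:E)%E.
Proof.
move=> mA d0 u0 hA.
(* The slab is taken at the outer radius of the shell, the kernel at the inner one, of exponent
   [j.+1]. *)
apply: (@le_integral_geometric _ _ _ _ _ _ (fun j => slab y u (delta * 2^-1 ^+ j))
   (fun j => (delta * 2^-1 ^+ j.+1) `^ (- p))).
- exact: mA.
- exact: measurable_frac_ker.
- exact: frac_ker_ge0.
- by move=> j; exact: measurable_slab.
- by move=> j; exact: powR_ge0.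
- by rewrite !mulr_ge0 ?exprn_ge0 ?powR_ge0// ?invr_ge0 ltW.
- exact: near_ratio01.
- move=> w /hA[/andP[h1 h2] h3]; have [j /andP[h4 h5]] := dyadic_lt h1 h2.
  exists j; split; last first.
    by apply: ler_powRN => //; rewrite mulr_gt0 ?exprn_gt0.
  split => //; rewrite ler_pdivlMr// mulrC; apply: (le_trans h3).
  by rewrite lerXn2r ?nnegrE ?enorm_ge0 ?ltW// (le_lt_trans _ h5) ?enorm_ge0.
- move=> j; set x := delta * 2^-1 ^+ j.
  have x0 : 0 < x by rewrite mulr_gt0 ?exprn_gt0.
  apply: le_trans (lee_wpmul2l _ (lebrV_slab y x0 u0)) _.
    by rewrite lee_fin powR_ge0.
  rewrite -EFinM lee_fin le_eqVlt; apply/orP; left; apply/eqP.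
  rewrite exprSr (mulrA delta) -/x powRM ?invr_ge0 ?(ltW x0)// exprMn.
  have -> : 2^-1 `^ (- p) = 2 `^ p :> R.
    by rewrite -powR_inv1// -powRrM mulrN mulN1r opprK.
  transitivity (2 * 2 `^ p * 4 ^+ n / enorm u * (x `^ (- p) * x ^+ n * x)); first by ring.
  rewrite powR_nat_add//.
  have -> : x `^ (- s) * x = x `^ (1 - s).
    rewrite -{2}(powRr1 (ltW x0)) -powRD; last by apply/implyP => _; rewrite gt_eqF.
    by congr powR; ring.
  rewrite powR_mul_expr// -/near_ratio.
  have -> : delta `^ (1 - s) = delta * delta `^ (- s).
    rewrite powRD ?powRr1 ?ltW//; by apply/implyP => _; rewrite gt_eqF.
  by ring.
Qed.

End kernel.

(** * Truncated curvature *)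

Section curvature.
Variables (R : realType) (n : nat) (s : R).
Hypothesis s01 : 0 < s < 1.
Local Notation la := (lebrV R n).
Local Notation p := (n%:R + s).
Local Notation ker := (@frac_ker R n s).
Implicit Types (y z w u : 'rV[R]_n) (E A B : set 'rV[R]_n).
Implicit Types (delta eps eta t : R).

Definition kint y A : \bar R := (\int[la]_(w in A) (ker y w)%:E)%E.

Lemma measurable_EFin_ker y A : measurable_fun A (fun w => (ker y w)%:E).
Proof. by apply/measurable_EFinP/measurable_funTS; exact: measurable_frac_ker. Qed.

Lemma kint_ge0 y A : (0 <= kint y A)%E.
Proof. by apply: integral_ge0 => w _; rewrite lee_fin frac_ker_ge0. Qed.

Lemma le_kint y A B : measurable A -> measurable B -> A `<=` B ->
  (kint y A <= kint y B)%E.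
Proof.
move=> mA mB AB; apply: ge0_subset_integral => //.
- exact: measurable_EFin_ker.
- by move=> w _; rewrite lee_fin frac_ker_ge0.
Qed.

Lemma kintU y A B : measurable A -> measurable B -> A `&` B = set0 ->
  (kint y (A `|` B) = kint y A + kint y B)%E.
Proof.
move=> mA mB AB; apply: ge0_integral_setU => //.
- exact: measurable_EFin_ker.
- by move=> w _; rewrite lee_fin frac_ker_ge0.
- by rewrite disj_set2E AB eqxx.
Qed.

Lemma kint_indic y A : measurable A ->
  (kint y A = \int[la]_w (\1_A w * ker y w)%:E)%E.
Proof.
move=> mA; rewrite /kint integral_mkcond; apply: eq_integral => w _.
by rewrite patchE indicE; case: (w \in A); rewrite ?mul1r ?mul0r.
Qed.

Lemma measurable_indic_ker y A : measurable A ->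
  measurable_fun setT (fun w => (\1_A w * ker y w)%:E : \bar R).
Proof.
move=> mA; apply/measurable_EFinP; apply: measurable_funM.
  exact: measurable_indic.
exact: measurable_frac_ker.
Qed.

(** Finiteness is what permits subtracting these integrals and passing to real arithmetic. *)
Lemma kint_far_fin_num y eps A : 0 < eps -> measurable A -> A `<=` far y eps ->
  kint y A \is a fin_num.
Proof.
move=> e0 mA AB; rewrite ge0_fin_numE ?kint_ge0//.
apply: (le_lt_trans (le_kint y mA (measurable_far y eps) AB)).
have [r0 r1] := andP (far_ratio01 s01).
(* [2 ^+ n] is the density of the whole space, as a cube of radius [r] has volume [(2 * r) ^+ n]. *)
have := @integral_far_le R n s s01 setT y eps (2 ^+ n) measurableT e0
  (exprn_ge0 _ (ler0n _ _)).
rewrite setTI => /(_ _)/le_lt_trans; apply; last by rewrite ltry.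
move=> j; rewrite setTI lebrV_cube ?mulr_gt0 ?exprn_gt0//.
rewrite lee_fin exprMn ler_wpM2r//; first by rewrite exprn_ge0// mulr_ge0// ltW// exprn_gt0.
by rewrite ler_peMr// invf_ge1 ?exprn_gt0// exprn_ile1// ltW.
Qed.

(** The positive part of the truncated integrand is the kernel on the complement of [E], the
    negative part the kernel on [E]. *)
Lemma Hs_truncE E y eps : measurable E ->
  Hs_trunc s E y eps = (kint y (~` E `&` far y eps) - kint y (E `&` far y eps))%E.
Proof.
move=> mE; have mF := measurable_far y eps; have mEc := measurableC mE.
have mA := measurableI _ _ mE mF; have mB := measurableI _ _ mEc mF.
rewrite /Hs_trunc /intd !kint_indic// !integral_lebrV//; last 4 first.
- exact: measurable_indic_ker.
- by move=> w; rewrite lee_fin mulr_ge0// frac_ker_ge0.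
- exact: measurable_indic_ker.
- by move=> w; rewrite lee_fin mulr_ge0// frac_ker_ge0.
have farE w : (w \in far y eps) = ~~ `[< eball y eps w >].
  apply/idP/asboolPn => [/set_mem h|h]; [|apply/mem_set].
    by apply/negP; rewrite -leNgt.
  by rewrite /far/= leNgt; exact/negP.
have kE w : enorm (y - w) `^ p = (ker y w)^-1.
  by rewrite /frac_ker powRN invrK enormB.
have k0 w := @frac_ker_ge0 R n s y w.
congr (_ - _)%E; congr iter_int; apply/funext => w; congr EFin;
  rewrite /chit kE invrK !indicE !in_setI farE in_setC;
  case: ifP => _ /=; rewrite ?andbF ?andbT ?mul0r ?oppr0 ?maxxx//;
  case: (w \in E) => /=; rewrite ?sub0r ?subr0 ?mul1r ?mulN1r ?mul0r ?opprK;
  by [rewrite max_r ?oppr_le0|rewrite max_l].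
Qed.

(** A lower bound valid for all small [eps] passes to the limit, which would be [0 < m]. *)
Lemma not_Hs_zero E y e0 m : 0 < e0 -> 0 < m ->
  (forall eps, 0 < eps < e0 -> (m%:E <= Hs_trunc s E y eps)%E) ->
  ~ Hs_zero_at s E y.
Proof.
move=> e00 m0 hm H.
have : (m%:E <= lim (Hs_trunc s E y @ 0^'+))%E.
  apply: lime_ge; first exact: cvgP H.
  near=> eps; apply: hm; apply/andP; split; near: eps.
    exact: nbhs_right_gt.
  exact: nbhs_right_lt.
by rewrite (cvg_lim _ H)// lee_fin leNgt m0.
Unshelve. all: by end_near. Qed.

(** The coefficient of [integral_far_ge]; [C_near] is that of [integral_slab_le]. *)
Definition c_far : R := 2 ^+ n * (3 * n%:R) `^ (- p).
Definition C_near : R := 2 * 2 `^ p * 4 ^+ n / (1 - near_ratio s).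
(** The density for which [integral_far_le] yields the coefficient [c_far / 8]. *)
Definition theta : R := c_far * (1 - far_ratio s) / (8 * 2 ^+ n).

Hypothesis n_gt0 : (0 < n)%N.

Lemma c_far_gt0 : 0 < c_far.
Proof. by rewrite mulr_gt0 ?exprn_gt0 ?powR_gt0// mulr_gt0// ltr0n. Qed.

Lemma C_near_gt0 : 0 < C_near.
Proof.
have [_ r1] := andP (near_ratio01 s01).
by rewrite divr_gt0 ?subr_gt0// !mulr_gt0 ?exprn_gt0 ?powR_gt0.
Qed.

Lemma theta_gt0 : 0 < theta.
Proof.
have [_ r1] := andP (far_ratio01 s01).
apply: divr_gt0; last by rewrite mulr_gt0 ?exprn_gt0.
by apply: mulr_gt0; [exact: c_far_gt0|rewrite subr_gt0].
Qed.

(* The weight [far_ratio s ^- j] makes the condition void at large scales, where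
   nothing is known about [E]. *)
Definition thin_at E y delta := forall j,
  (la (E `&` cube y (delta * 2 ^+ j.+1)) <=
     (theta / far_ratio s ^+ j * (delta * 2 ^+ j.+1) ^+ n)%:E)%E.

(** The two integrals add up to at least the bound of [integral_far_ge], and [E] takes at most one
    eighth of that bound; the difference keeps [1 - 2 / 8] of it. *)
Lemma kint_far_gap E y delta : measurable E -> 0 < delta -> thin_at E y delta ->
  (kint y (E `&` far y delta) + (3 / 4 * c_far * delta `^ (- s))%:E <=
   kint y (~` E `&` far y delta))%E.
Proof.
move=> mE d0 thin; have mF := measurable_far y delta; have mEc := measurableC mE.
have mA := measurableI _ _ mE mF; have mB := measurableI _ _ mEc mF.
have [_ r1] := andP (far_ratio01 s01).
have h1 : (kint y (E `&` far y delta) <= (c_far / 8 * delta `^ (- s))%:E)%E.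
  apply: (le_trans (integral_far_le s01 mE d0 (ltW theta_gt0) thin)).
  rewrite lee_fin le_eqVlt; apply/orP; left; apply/eqP; rewrite /theta; field.
  by rewrite expf_neq0//= subr_eq0 gt_eqF.
have h2 := integral_far_ge s01 y n_gt0 d0; rewrite -/c_far in h2.
have h3 : (kint y (far y delta) =
    kint y (E `&` far y delta) + kint y (~` E `&` far y delta))%E.
  rewrite -kintU//; last by rewrite setIACA setICr set0I.
  by rewrite -setIUl setUv setTI.
move: h2; rewrite -/(kint y (far y delta)) h3 => {h3}.
have fA := @kint_far_fin_num y delta _ d0 mA (@subIsetr _ _ _).
have fB := @kint_far_fin_num y delta _ d0 mB (@subIsetr _ _ _).
move: h1; rewrite -(fineK fA) -(fineK fB) -!EFinD !lee_fin.
set a := fine _; set b := fine _; set x := c_far * delta `^ (- s).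
rewrite (_ : c_far / 8 * _ = x / 8); last by rewrite /x; ring.
rewrite (_ : 3 / 4 * c_far * _ = 3 / 4 * x); last by rewrite /x; ring.
by clearbody a b x; lra.
Qed.

(* Inside [B_delta(y)] the part of [E] whose reflection through [y] falls in the
   exterior ball is compensated by its mirror image; the rest lies between the
   two balls of radius [t] tangent at [y]. *)
Lemma kint_near_le E y z eps delta : measurable E -> 0 < eps -> 0 < delta ->
  0 < enorm (z - y) -> (forall w, E w -> enorm (z - y) <= enorm (w - z)) ->
  (kint y (E `&` (far y eps `\` far y delta)) <=
   kint y (~` E `&` (far y eps `\` far y delta)) +
   (C_near * (delta / enorm (z - y)) * delta `^ (- s))%:E)%E.
Proof.
move=> mE e0 d0; set u := z - y => u0 hE.
set ann := far y eps `\` far y delta.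
have mann : measurable ann by apply: measurableD; exact: measurable_far.
have mEc := measurableC mE.
(* Reflection through [y] sends [w] to [c - w]. The set [S] is what it cannot compensate: the points
   of the annulus outside both the ball centred at [z] and its mirror image. *)
pose c := y + y.
pose S : set 'rV[R]_n := ann `&` [set w | enorm u <= enorm (w - z)] `&`
  [set w | enorm u <= enorm (w - (c - z))].
have mS : measurable S.
  by apply: measurableI; [apply: measurableI => //|];
    apply: measurable_set_le => //; exact: measurable_enorm.
have hS w : S w -> 0 < enorm (w - y) < delta /\
     2 * `|dotv (w - y) u| <= enorm (w - y) ^+ 2.
  move=> [[[/= h1 h2] h3] h4]; split.
    by rewrite (lt_le_trans e0 h1)/= ltNge; exact/negP.
  have sq (a : 'rV[R]_n) : enorm u <= enorm a -> dotv u u <= dotv a a.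
    by move=> h; rewrite -!enorm_sq lerXn2r ?nnegrE ?enorm_ge0.
  have e1 : w - z = (w - y) - u by rewrite /u; apply/rowP => i; rewrite !mxE; ring.
  have e2 : w - (c - z) = (w - y) + u by rewrite /u /c; apply/rowP => i; rewrite !mxE; ring.
  (* Expanding the squared norms of [v - u] and [v + u], both at least that of [u], bounds
     [dotv v u] from both sides. *)
  move: (sq _ h3) (sq _ h4); rewrite e1 e2 enorm_sq; set v := w - y.
  rewrite dotv_sqrB dotv_sqrD; set a := dotv v v; set b := dotv v u; set d := dotv u u.
  by clearbody a b d => ? ?; case: (ger0P b) => ?; lra.
have kc w : ker y (c - w) = ker y w.
  rewrite /frac_ker -enormN; congr (enorm _ `^ _).
  by apply/rowP => i; rewrite /c !mxE; ring.
have annc w : ann (c - w) <-> ann w.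
  have e : enorm (c - w - y) = enorm (w - y).
    by rewrite -enormN; congr enorm; rewrite /c; apply/rowP => i; rewrite !mxE; ring.
  by rewrite /ann /far/= e.
pose f w := (\1_(~` E `&` ann) w * ker y w)%:E.
have mER := measurableI _ _ mE mann; have mEcR := measurableI _ _ mEc mann.
have mf : measurable_fun setT f by exact: measurable_indic_ker.
have f0 w : (0 <= f w)%E by rewrite lee_fin mulr_ge0// frac_ker_ge0.
have mfc : measurable_fun setT (fun w => f (c - w)).
  have := measurableT_comp (measurableT_comp mf (measurable_rV_translation c))
    (@measurable_rV_opp R n).
  by apply: eq_measurable_fun => w _ /=; rewrite addrC.
(* For [w] in [E], either [c - w] is outside [E] and the reflected term pays, or both points are in
   [E] and the exterior ball forces [w] into [S]. *)
apply: (@le_trans _ _ (\int[la]_w ((\1_S w * ker y w)%:E + f (c - w)%R))%E).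
  rewrite kint_indic//; apply: ge0_le_integral => //.
  - by move=> w _; rewrite lee_fin mulr_ge0// frac_ker_ge0.
  - exact: measurable_indic_ker.
  - by apply: emeasurable_funD => //; exact: measurable_indic_ker.
  move=> w _; rewrite -EFinD lee_fin kc -mulrDl ler_wpM2r ?frac_ker_ge0//.
  have [ERw|] := boolP (w \in E `&` ann); last first.
    by move=> /negbTE ERw; rewrite indicE ERw addr_ge0.
  have [Ew Rw] := set_mem ERw.
  have [Ecw|Ecw] := pselect (E (c - w)).
    rewrite [\1_S _]indicE mem_set ?indicE ?ERw ?lerDl//.
    split; first by split => //; exact: hE.
    rewrite /= [X in _ <= X]enormB (_ : c - z - w = c - w - z); last by rewrite addrAC.
    exact: hE.
  rewrite [\1_(~` E `&` ann) _]indicE mem_set; last by split => //; exact/annc.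
  by rewrite indicE ERw lerDr.
rewrite ge0_integralD//; last 2 first.
- by move=> w _; rewrite lee_fin mulr_ge0// frac_ker_ge0.
- exact: measurable_indic_ker.
rewrite integral_lebrV_reflection// -!kint_indic// addeC leeD2l//.
apply: (le_trans (integral_slab_le s01 mS d0 u0 hS)).
rewrite lee_fin le_eqVlt; apply/orP; left; apply/eqP; rewrite /C_near.
by ring.
Qed.

(** Splitting at radius [delta], the far part gains three quarters and the near part loses at most
    one quarter of the same quantity. The remaining half does not depend on [eps]. *)
Lemma Hs_trunc_touching E y z delta eps : measurable E ->
  0 < eps < delta -> 0 < enorm (z - y) ->
  (forall w, E w -> enorm (z - y) <= enorm (w - z)) ->
  C_near * (delta / enorm (z - y)) <= c_far / 4 ->
  thin_at E y delta ->
  ((c_far / 2 * delta `^ (- s))%:E <= Hs_trunc s E y eps)%E.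
Proof.
move=> mE /andP[e0 ed] u0 hE hC thin; have d0 := lt_trans e0 ed.
rewrite Hs_truncE//.
have mFd := measurable_far y delta; have mFe := measurable_far y eps.
have mring : measurable (far y eps `\` far y delta) by exact: measurableD.
have split_far A : measurable A -> (kint y (A `&` far y eps) =
    kint y (A `&` (far y eps `\` far y delta)) + kint y (A `&` far y delta))%E.
  move=> mA; rewrite -kintU; [|exact: measurableI|exact: measurableI|].
    congr kint; rewrite -setIUr; congr (_ `&` _); rewrite setUC setDUK//.
    by move=> w; rewrite /far/=; apply: le_trans; exact: ltW.
  by rewrite setIACA setDKI setI0.
have mEc := measurableC mE.
have fin A : measurable A -> A `<=` far y eps -> kint y A \is a fin_num.
  exact: kint_far_fin_num.
have sub : far y delta `<=` far y eps.
  by move=> w; rewrite /far/=; apply: le_trans; exact: ltW.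
have := kint_near_le mE e0 d0 u0 hE; have := kint_far_gap mE d0 thin.
rewrite !split_far//.
have f1 := fin _ (measurableI _ _ mE mring) (fun w h => h.2.1).
have f2 := fin _ (measurableI _ _ mEc mring) (fun w h => h.2.1).
have f3 := fin _ (measurableI _ _ mE mFd) (fun w h => sub w h.2).
have f4 := fin _ (measurableI _ _ mEc mFd) (fun w h => sub w h.2).
rewrite -(fineK f1) -(fineK f2) -(fineK f3) -(fineK f4) -!EFinD !lee_fin.
have := ler_wpM2r (powR_ge0 delta (- s)) hC.
set a1 := fine _; set a2 := fine _; set a3 := fine _; set a4 := fine _.
rewrite (_ : c_far / 4 * _ = c_far * delta `^ (- s) / 4); last by ring.
rewrite (_ : c_far / 2 * _ = c_far * delta `^ (- s) / 2); last by ring.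
rewrite (_ : 3 / 4 * c_far * _ = 3 / 4 * (c_far * delta `^ (- s))); last by ring.
set x := c_far * delta `^ (- s); set k := C_near * _ * _.
by clearbody a1 a2 a3 a4 x k; lra.
Qed.

(** Serves the case where the nearest point is [z] itself: cutting at [eps] leaves no near part to
    estimate. *)
Lemma Hs_trunc_thin E y eps : measurable E -> 0 < eps -> thin_at E y eps ->
  ((c_far / 2 * eps `^ (- s))%:E <= Hs_trunc s E y eps)%E.
Proof.
move=> mE e0 thin; rewrite Hs_truncE//; have := kint_far_gap mE e0 thin.
have mF := measurable_far y eps; have mEc := measurableC mE.
have f1 := kint_far_fin_num e0 (measurableI _ _ mE mF) (@subIsetr _ _ _).
have f2 := kint_far_fin_num e0 (measurableI _ _ mEc mF) (@subIsetr _ _ _).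
rewrite -(fineK f1) -(fineK f2) -!EFinD !lee_fin.
have : 0 <= c_far * eps `^ (- s) by rewrite mulr_ge0 ?powR_ge0// ltW// c_far_gt0.
rewrite (_ : c_far / 2 * _ = c_far * eps `^ (- s) / 2); last by ring.
rewrite (_ : 3 / 4 * c_far * _ = 3 / 4 * (c_far * eps `^ (- s))); last by ring.
set x := c_far * eps `^ (- s); set a := fine _; set b := fine _.
by clearbody a b x; lra.
Qed.

End curvature.

(** * Transport of thinness to a nearest point of the closure *)

Lemma exists_expr_le (R : realType) (r e : R) : 0 < r < 1 -> 0 < e ->
  exists J : nat, r ^+ J <= e.
Proof.
move=> /andP[r0 r1] e0.
have /cvgrPdist_lt/(_ e e0)[J _ hJ] : geometric 1 r @ \oo --> (0 : R).
  by apply: cvg_geometric; rewrite ger0_norm// ltW.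
exists J; have := hJ J (leqnn J); rewrite /= mul1r sub0r normrN ger0_norm.
  exact: ltW.
by rewrite exprn_ge0// ltW.
Qed.

Section transfer.
Variables (R : realType) (n : nat) (s : R).
Hypothesis s01 : 0 < s < 1.
Local Notation la := (lebrV R n).

(** Below index [J], the cubes at [y] lie in cubes at [z] larger by the factor [1 + b], whose low
    density is known. From [J] on, the allowed mass exceeds the full volume of the cube. *)
Lemma thin_at_near (E : set 'rV[R]_n) (y z : 'rV[R]_n) (delta t rho eta b : R)
    (J : nat) :
  measurable E -> 0 < delta -> 0 <= eta -> 0 < b ->
  t <= delta * b -> (forall i, `|y 0 i - z 0 i| <= t) ->
  eta * (1 + b) ^+ n <= theta n s -> 2 ^+ n * far_ratio s ^+ J <= theta n s ->
  delta * 2 ^+ J * (1 + b) <= rho ->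
  (forall r, 0 < r -> r <= rho -> (la (E `&` cube z r) < (eta * r ^+ n)%:E)%E) ->
  thin_at s E y delta.
Proof.
move=> mE d0 eta0 b0 tb yz heta hJ hrho low j.
have [r0 r1] := andP (far_ratio01 s01).
set x := delta * 2 ^+ j.+1.
have dx : delta <= x by rewrite ler_peMr ?exprn_ege1 ?ler1n// ltW.
have x0 := lt_le_trans d0 dx.
have xn0 : 0 <= x ^+ n by rewrite exprn_ge0// ltW.
have mc v a := measurable_cube (v : 'rV[R]_n) a.
have rj0 : 0 < far_ratio s ^+ j by rewrite exprn_gt0.
have [jJ|Jj] := ltnP j J.
  have b1 : 0 < 1 + b by rewrite addr_gt0.
  (* The centres differ by at most [t <= delta * b <= x * b] in each coordinate. *)
  apply: (@le_trans _ _ (la (E `&` cube z (x * (1 + b))))).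
    apply: le_lebrV; [exact: measurableI|exact: measurableI|].
    apply: setIS; apply: subset_cube => i.
    have := yz i; have := ler_wpM2r (ltW b0) dx; lra.
  apply: (le_trans (ltW (low _ _ _))); first by rewrite mulr_gt0.
    apply: le_trans hrho; rewrite (ler_wpM2r (ltW b1))//.
    by rewrite ler_pM2l// ler_eXn2l// ltr1n.
  rewrite lee_fin exprMn mulrCA mulrC (ler_wpM2r xn0)//.
  apply: (le_trans heta); rewrite ler_peMr//.
    by apply: le_trans heta; rewrite mulr_ge0// exprn_ge0// ltW.
  by rewrite invf_ge1// exprn_ile1// ltW.
apply: (@le_trans _ _ (la (cube y x))).
  by apply: le_lebrV; [exact: measurableI| |exact: subIsetr].
rewrite lebrV_cube// lee_fin exprMn (ler_wpM2r xn0)//.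
rewrite ler_pdivlMr//; apply: le_trans hJ; rewrite ler_wpM2l ?exprn_ge0//.
by rewrite ler_wiXn2l// ltW.
Qed.

(** The closed ball about [z] of radius [enorm z] contains [0], so its intersection with the closure
    is compact and nonempty; points of [E] outside the ball are farther away. *)
Lemma exists_nearest_point (E : set 'rV[R]_n) (z : 'rV[R]_n) : closure E 0 ->
  exists y, [/\ closure E y, enorm (y - z) <= enorm z &
    forall w, E w -> enorm (y - z) <= enorm (w - z)].
Proof.
move=> E0.
pose K := closure E `&` [set w | enorm (w - z) <= enorm z].
have cK : compact K.
  apply: bounded_closed_compact.
    exists (enorm z + enorm z); split; first exact: num_real.
    move=> M hM w [_ /= wz]; rewrite [leLHS]/Num.norm/= mx_normrE.
    apply: bigmax_le; first by apply: le_trans (ltW hM); rewrite addr_ge0 ?enorm_ge0.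
    move=> [i j] _ /=; rewrite ord1; apply: le_trans (ltW hM).
    have h1 := le_trans (coord_le_enorm (w - z) j) wz.
    have h2 := coord_le_enorm z j.
    move: h1; rewrite !mxE => h1.
    rewrite -(subrK (z 0 j) (w 0 j)); exact: le_trans (ler_normD _ _) (lerD h1 h2).
  apply: closedI; first exact: closed_closure.
  have := @closed_le R (enorm z).
  move=> /(closed_comp (fun w _ => @continuous_enorm R n z w)).
  exact.
have K0 : K !=set0 by exists 0; split => //=; rewrite sub0r enormN.
have [y yK ymin] := EVT_min_rV K0 cK (continuous_subspaceT (@continuous_enorm R n z)).
have [cy yz] := set_mem yK; exists y; split => // w Ew.
have [wz|/ltW zw] := leP (enorm (w - z)) (enorm z); last exact: le_trans zw.
by apply: ymin; apply/mem_set; split => //; exact: subset_closure.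
Qed.

(** From an interior point of [E] one could move towards [z] and remain in [E]. *)
Lemma nearest_point_boundary (E : set 'rV[R]_n) (y z : 'rV[R]_n) : ~ E z ->
  closure E y -> (forall w, E w -> enorm (y - z) <= enorm (w - z)) ->
  boundary E y.
Proof.
move=> nEz cy ymin; split => // /nbhs_cubeP[e e0 eE].
have [t0|t0] := eqVneq (enorm (y - z)) 0.
  apply: nEz; rewrite -(subr0_eq (enorm_eq0 t0)).
  exact/eE/cube_center.
have {}t0 : 0 < enorm (y - z) by rewrite lt_def t0 enorm_ge0.
set t := enorm (y - z) in ymin t0.
have et0 : 0 < e + t by rewrite addr_gt0.
(* At distance [e * t / (e + t) < e] from [y] and [t ^+ 2 / (e + t) < t] from [z]. *)
pose w := z + (t / (e + t)) *: (y - z).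
have : E w.
  apply: eE => i.
  have -> : w 0 i - y 0 i = - (e / (e + t)) * (y - z) 0 i.
    by rewrite /w !mxE; field; rewrite gt_eqF.
  have k0 : 0 <= e / (e + t) by rewrite divr_ge0// ltW.
  rewrite normrM normrN (ger0_norm k0); apply: (@le_lt_trans _ _ (e / (e + t) * t)).
    by rewrite ler_wpM2l// coord_le_enorm.
  by rewrite mulrAC ltr_pdivrMr// ltr_pM2l// ltrDr.
have k0 : 0 <= t / (e + t) by rewrite divr_ge0// ltW.
move/ymin; rewrite /w (addrC z) addrK enormZ -/t (ger0_norm k0).
by rewrite mulrAC ler_pdivlMr// ler_pM2l// gerDr leNgt e0.
Qed.

End transfer.

(* d = n.+1 >= 1 *)
Theorem theorem1p1 (R : realType) (n : nat) (s : R) :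
  0 < s < 1 ->
  exists C : R, 0 < C /\
  forall (alpha : R) (E : set 'rV[R]_n.+1),
    s < alpha < 1 ->
    open E -> C1alpha_boundary alpha E -> boundary E (0 : 'rV[R]_n.+1) ->
    (forall x, boundary E x -> Hs_zero_at s E x) ->
    forall Rad : R, 0 < Rad ->
      (C%:E * lebd (eball (0 : 'rV[R]_n.+1) Rad) <= lebd (E `&` eball (0 : 'rV[R]_n.+1) Rad))%E.
Proof.
move=> s01; set d := n.+1.
have d_gt0 : (0 < d)%N by [].
have cf0 := c_far_gt0 s d_gt0; have Cn0 := C_near_gt0 d s01.
have th0 := theta_gt0 s01 d_gt0.
set cf := c_far d s in cf0; set Cn := C_near d s in Cn0; set th := theta d s in th0.
(* With [delta = t / b], the near coefficient [Cn * (delta / t)] is exactly [cf / 4]. *)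
pose b : R := 4 * Cn / cf.
have b0 : 0 < b by rewrite divr_gt0// mulr_gt0.
have b1 : 0 < 1 + b by rewrite addr_gt0.
(* The bound [1] keeps [z] out of [E]; the other one pays for the dilation by [1 + b] in
   [thin_at_near]. *)
pose eta := Num.min 1 (th / (1 + b) ^+ d).
have eta0 : 0 < eta by rewrite lt_min ltr01/= divr_gt0 ?exprn_gt0.
have eta1 : eta <= 1 by rewrite ge_min lexx.
have etath : eta * (1 + b) ^+ d <= th.
  by rewrite -ler_pdivlMr ?exprn_gt0// ge_min lexx orbT.
have [J hJ] : exists J : nat, 2 ^+ d * far_ratio s ^+ J <= th.
  have [J hJ] := exists_expr_le (far_ratio01 s01) (divr_gt0 th0 (exprn_gt0 d (ltr0Sn R 1))).
  by exists J; rewrite mulrC -ler_pdivlMr ?exprn_gt0.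
have dR0 : 0 < d%:R :> R by rewrite ltr0n.
(* The ratio [rho / a]: as [t <= d * a], the radius [rho] then reaches
   [delta * 2 ^+ J * (1 + b)]. *)
pose L : R := d%:R / b * 2 ^+ J * (1 + b).
have L0 : 0 < L by rewrite !mulr_gt0 ?invr_gt0 ?exprn_gt0.
have L1 : 0 < 1 + L by rewrite addr_gt0.
(* Makes [d * (a + rho) = Rad / 2], so that [cube 0 (a + rho)] fits in the ball. *)
pose k : R := (2 * d%:R * (1 + L))^-1.
have k0 : 0 < k by rewrite invr_gt0 !mulr_gt0.
(* The threshold [eta * (2 * a) ^+ d / 6 ^+ d] of [exists_low_density], divided by the volume
   [(2 * Rad) ^+ d] of a cube containing the ball. *)
exists (eta * k ^+ d / 6 ^+ d); split.
  by rewrite !mulr_gt0 ?invr_gt0 ?exprn_gt0.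
move=> alpha E _ oE _ [cE0 _] HE Rad R0.
have mE := open_measurable_rV oE.
have mB := measurable_eball (0 : 'rV[R]_d) Rad.
rewrite !lebd_lebrV//; last exact: measurableI.
rewrite leNgt; apply/negP => small.
pose a := k * Rad; have a0 : 0 < a by rewrite mulr_gt0.
pose rho := a * L; have rho0 : 0 < rho by rewrite mulr_gt0.
have sub : cube 0 (a + rho) `<=` eball (0 : 'rV[R]_d) Rad.
  move=> w hw; apply: (@le_lt_trans _ _ (d%:R * (a + rho))).
    apply: enorm_le; first by rewrite addr_ge0 ?ltW.
    by move=> i; have := hw i; rewrite !mxE => /ltW.
  rewrite (_ : _ * _ = Rad / 2); first by lra.
  by rewrite /rho /a /k; field; rewrite !gt_eqF.
have mC := measurable_cube (0 : 'rV[R]_d).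
have [z [za low]] : exists z : 'rV[R]_d, (forall i, `|z 0 i| <= a) /\
    forall r, 0 < r -> r <= rho ->
      (lebrV R d (E `&` cube z r) < (eta * r ^+ d)%:E)%E.
  apply: exists_low_density => //; first exact: ltW.
  apply: (@le_lt_trans _ _ ((6 ^+ d)%:E * lebrV R d (E `&` eball 0%R Rad))%E).
    apply: lee_wpmul2l; first by rewrite lee_fin exprn_ge0.
    by apply: le_lebrV; [exact: measurableI|exact: measurableI|exact: setIS].
  rewrite muleC -lte_pdivlMr ?exprn_gt0//; apply: (lt_le_trans small).
  apply: (@le_trans _ _ ((eta * k ^+ d / 6 ^+ d)%:E * lebrV R d (cube 0%R Rad))%E).
    apply: lee_wpmul2l; first by rewrite lee_fin !mulr_ge0 ?invr_ge0 ?exprn_ge0// ltW.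
    by apply: le_lebrV => //; exact: eball_sub_cube.
  rewrite lebrV_cube// -!EFinM lee_fin le_eqVlt; apply/orP; left; apply/eqP.
  by rewrite /a !exprMn; field; rewrite expf_neq0.
(* A small cube about [z] inside [E] would have mass [(2 * r) ^+ d], too much since [eta <= 1]. *)
have nEz : ~ E z.
  move=> Ez; have /nbhs_cubeP[e e0 eE] : nbhs z E by exact: open_nbhs_nbhs.
  pose r := Num.min e rho.
  have r0 : 0 < r by rewrite lt_min e0.
  have := low r r0; rewrite ge_min lexx orbT => /(_ isT).
  rewrite setIidr; last first.
    apply: subset_trans eE; apply: subset_cube => i.
    by rewrite subrr normr0 add0r ge_min lexx.
  rewrite lebrV_cube// lte_fin exprMn ltr_pM2r ?exprn_gt0// ltNge => /negP; apply.
  by apply: (le_trans eta1); rewrite exprn_ege1// ler1n.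
have [y [cEy yz ymin]] := exists_nearest_point z cE0.
have Hy := HE y (nearest_point_boundary nEz cEy ymin).
set t := enorm (y - z) in yz ymin.
have ta : t <= d%:R * a by apply: (le_trans yz); apply: enorm_le => //; exact: ltW.
have yzt i : `|y 0 i - z 0 i| <= t.
  by have := coord_le_enorm (y - z) i; rewrite !mxE.
have [t0|t0] := eqVneq t 0.
  (* Below [1], the power [- s] of [eps] is at least one; the second bound keeps the scales used by
     [thin_at_near] under [rho]. *)
  pose e0 := Num.min 1 (rho / (2 ^+ J * (1 + b))).
  have e00 : 0 < e0 by rewrite lt_min ltr01 divr_gt0// mulr_gt0// exprn_gt0.
  have m0 : 0 < cf / 2 by rewrite divr_gt0.
  apply: (not_Hs_zero e00 m0 _ Hy) => eps /andP[eps0 epse].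
  have eps1 : eps <= 1 by apply: (le_trans (ltW epse)); rewrite ge_min lexx.
  have thin : thin_at s E y eps.
    apply: (thin_at_near (z := z) (t := t) (rho := rho) s01 mE eps0 (ltW eta0) b0 _ yzt etath hJ) => //.
      by rewrite t0 mulr_ge0 ?ltW.
    rewrite -mulrA -ler_pdivlMr ?mulr_gt0 ?exprn_gt0//.
    by apply: (le_trans (ltW epse)); rewrite ge_min lexx orbT.
  apply: le_trans (Hs_trunc_thin s01 d_gt0 mE eps0 thin).
  rewrite lee_fin -/cf ler_peMr ?(ltW m0)// powRN invf_ge1 ?powR_gt0//.
  have [s0 _] := andP s01.
  have <- : 1 `^ s = 1 :> R by rewrite powR1.
  by apply: ge0_ler_powR; rewrite ?nnegrE// ltW.
have {}t0 : 0 < t by rewrite lt_def t0 enorm_ge0.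
pose delta := t / b; have d0 : 0 < delta by rewrite divr_gt0.
have thin : thin_at s E y delta.
  apply: (thin_at_near (z := z) (t := t) (rho := rho) s01 mE d0 (ltW eta0) b0 _ yzt etath hJ) => //.
    by rewrite divfK// gt_eqF.
  rewrite (_ : rho = d%:R * a / b * 2 ^+ J * (1 + b)); last by rewrite /rho /L; ring.
  apply: (ler_wpM2r (ltW b1)); apply: ler_wpM2r; first by rewrite exprn_ge0.
  by apply: ler_wpM2r => //; rewrite invr_ge0 ltW.
have tE : enorm (z - y) = t by rewrite enormB.
have m0 : 0 < cf / 2 * delta `^ (- s) by rewrite mulr_gt0 ?powR_gt0// divr_gt0.
apply: (not_Hs_zero d0 m0 _ Hy) => eps epsd.
apply: (@Hs_trunc_touching _ _ _ s01 d_gt0 E y z) => //; rewrite tE//.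
rewrite -/cf -/Cn le_eqVlt; apply/orP; left; apply/eqP.
by rewrite /delta /b; field; rewrite !gt_eqF.
Qed.
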